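(* Let $\underline{\eta}=[\eta_1,\dots,\eta_s]$ be an unordered collection of partitions of $d$ specifying the cycle types of branching of degree $d$ covers of $\mathbb{P}^1$ by connected curves of genus $g$. If $\underline{\eta}$ contains at most one $\eta_i$ that is not pure, and at least $3g+(d-1)$ of the $\eta_i$ are transpositions (i.e. of cycle type $(2,1^{d-2})$), then the Hurwitz space $\mathrm{Hur}(\underline{\eta})$ is irreducible.
   Context: All curves are over $\mathbb{C}$. A partition of $d$ is pure if exactly one of its entries is not equal to $1$. The Hurwitz space of type $\underline{\eta}$, $$\mathrm{Hur}(\underline{\eta})=\{f:C\to\mathbb{P}^1\mid \text{the ramification of } f\text{ is of type }\underline{\eta}\},$$ is the space of (isomorphism classes of) degree $d$ covers $f$ with $C$ a smooth connected projective curve, branched over exactly $s$ distinct points of $\mathbb{P}^1$ (allowed to vary), such that the ramification profiles over these points are, in some order, $\eta_1,\dots,\eta_s$. Each $\eta_i$ is a non-trivial partition. The genus $g$ of $C$ is determined by Riemann–Hurwitz: $2g-2=-2d+\sum_{i=1}^s(d-\ell(\eta_i))$, where $\ell(\eta_i)$ is the number of parts. Equivalently, covers correspond to conjugacy classes of tuples in $S_d$ with cycle types $\eta_i$, product one, generating a transitive subgroup, and irreducibility of $\mathrm{Hur}(\underline{\eta})$ is transitivity of the action on these classes obtained by moving the branch points. *)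

(* Defs.v *)
From mathcomp Require Import all_boot all_order all_algebra all_fingroup.

Set Implicit Arguments.
Unset Strict Implicit.
Unset Printing Implicit Defensive.

Import GroupScope.

(* Partitions are lists of positive parts in nonincreasing order, so that      *)
(* equality of partitions is equality of lists.                                *)
Definition is_partition_of (d : nat) (p : seq nat) : bool :=
  [&& sorted geq p, 0 \notin p & sumn p == d].

Definition pure (p : seq nat) : bool := count (predC1 1%N) p == 1%N.

Definition transposition_type (d : nat) : seq nat := 2 :: nseq (d - 2) 1%N.

(* Fixed points are one-element members of porbits, hence contribute parts 1.  *)
Definition cycle_type (d : nat) (x : 'S_d) : seq nat :=
  sort geq (map (fun c : {set 'I_d} => #|c|) (enum (porbits x))).

(* Monodromy tuples of the connected covers of type eta.  Both eta and the     *)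
(* branch points are unordered, so the local cycle types only have to agree    *)
(* with eta up to reordering.                                                  *)
Definition hurwitz_tuple (d s : nat) (eta : s.-tuple (seq nat))
    (t : {ffun 'I_s -> 'S_d}) : bool :=
  [&& perm_eq [seq cycle_type (t i) | i : 'I_s] eta,
      \prod_(i < s) t i == 1
    & [transitive <<[set t i | i : 'I_s]>>, on [set: 'I_d] | 'P]].

Definition conj_tuple (d s : nat) (t : {ffun 'I_s -> 'S_d}) (g : 'S_d) :
    {ffun 'I_s -> 'S_d} :=
  [ffun i => t i ^ g].

Definition conj_class (d s : nat) (t : {ffun 'I_s -> 'S_d}) :
    {set {ffun 'I_s -> 'S_d}} :=
  [set conj_tuple t g | g : 'S_d].

(* By the Riemann existence theorem these classes are the isomorphism classes  *)
(* of covers of type eta with a fixed branch locus, i.e. a fibre of the finite *)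
(* covering Hur(eta) -> Conf_s(P^1).                                           *)
Definition hurwitz_classes (d s : nat) (eta : s.-tuple (seq nat)) :
    {set {set {ffun 'I_s -> 'S_d}}} :=
  [set conj_class t | t : {ffun 'I_s -> 'S_d} & hurwitz_tuple eta t].

(* For j = i + 1, the effect on monodromy of the half-twist exchanging the     *)
(* i-th and j-th branch points: (.., a, b, ..) |-> (.., b, b^-1 a b, ..).      *)
Definition braid_move (d s : nat) (i j : 'I_s) (t : {ffun 'I_s -> 'S_d}) :
    {ffun 'I_s -> 'S_d} :=
  [ffun k => if k == i then t j else if k == j then t i ^ t j else t k].

Lemma braid_move_inj (d s : nat) (i j : 'I_s) : injective (@braid_move d s i j).
Proof.
move=> t u /ffunP tu.
have tuj : t j = u j by have := tu i; rewrite !ffunE eqxx.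
have tui : t i = u i.
  have [ij|ij] := eqVneq j i; first by rewrite -ij.
  by have := tu j; rewrite !ffunE (negPf ij) eqxx tuj => /conjg_inj.
apply/ffunP => k; have := tu k; rewrite !ffunE.
by case: eqP => [->|_] //; case: eqP => [->|].
Qed.

Definition braid_perm (d s : nat) (i j : 'I_s) : {perm {ffun 'I_s -> 'S_d}} :=
  perm (@braid_move_inj d s i j).

(* The image of the braid group, i.e. of the fundamental group of Conf_s(P^1), *)
(* in the permutations of the s-tuples.                                        *)
Definition braid_group (d s : nat) : {group {perm {ffun 'I_s -> 'S_d}}} :=
  <<[set braid_perm d ij.1 ij.2 | ij : 'I_s * 'I_s
      & nat_of_ord ij.2 == ij.1.+1]>>%G.

(* Hur(eta) is smooth, so it is irreducible iff it is nonempty and connected,  *)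
(* i.e. iff the monodromy action on a fibre over Conf_s(P^1) is transitive     *)
(* (atrans also requires the set acted on to be nonempty).                     *)
Definition hurwitz_space_irreducible (d s : nat) (eta : s.-tuple (seq nat)) :
    Prop :=
  [transitive braid_group d s, on hurwitz_classes d eta | 'P^*].

(* Main.v *)
(* Write a monodromy tuple as [X ++ Tr], where [Tr] consists of the transpositions
   and all elements of [X] but the first are cycles; let [w] be the product of
   [X]. Riemann-Hurwitz and the hypothesis on the number of transpositions bound
   the total rank of [X] by [d - 1], where the rank of a permutation is [d] minus
   its number of cycles. A transposition joining two cycles of [w] within an
   orbit of [Tr] can be split off from [Tr] as a pair of equal transpositions;
   running one of them around an element of [X] conjugates this element. Such
   moves make [Tr] transitive and then raise the rank of [w] until it equals the
   total rank of [X]: the cycles in [X] then form a forest. Forests of the same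
   type are linked by moves conjugating one cycle at a time by a transposition.
   When [X] agrees for two tuples, so do the products of their transpositions,
   and a transitive list of transpositions is determined up to braiding by its
   product and its length. *)
Require Import Defs.
From mathcomp Require Import all_boot all_order all_algebra all_fingroup.
From mathcomp Require Import zify.

Set Implicit Arguments.
Unset Strict Implicit.
Unset Printing Implicit Defensive.

(** * Rank and cycles of permutations *)

(** The ranks of a whole tuple sum to [2 * d + 2 * g - 2], so [3 * g + (d - 1)] transpositions leave
    total rank at most [d - 1 - g] for the rest. Total rank below [d] is used three times: it gives
    a point whose orbit under [X] is a single cycle of [w], it leaves more than two cycles of [w] as
    long as the rank can still grow, and it leaves enough points to seat the cycles of a forest. The
    obstacle is that conjugating an element of [X] multiplies [w] by two transpositions, each of
    which may join or split, so that the rank can rise or fall by two or stay. Cycles make this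
    controllable: a cycle adds its full rank to a product exactly when its support meets each cycle
    of that product at most once. The first element is exempt because simultaneous conjugation of
    the tuple can be spent on it. A pair of equal transpositions is split off because the twist
    alters one copy, while the other keeps [Tr] as connected as before. *)

Definition rank (T : finType) (s : {perm T}) : nat := #|T| - #|porbits s|.

(* Generalizing the ranks first identifies the convertible instances of the
   group operations, which [lia] would see as distinct atoms. *)
Ltac rank_lia := rewrite ?doubleS ?double0; repeat move: (rank _) => ?; lia.

Section PermRank.
Local Open Scope group_scope.
Variable T : finType.
Implicit Types (s t x y z : {perm T}) (a b c p q : T) (Z P : {set T}).


Lemma card_porbits_le s : #|porbits s| <= #|T|.
Proof. exact: leq_imset_card. Qed.

Lemma porbits_rank s : #|porbits s| + rank s = #|T|.
Proof. by rewrite subnKC ?card_porbits_le. Qed.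

Lemma odd_rank s : odd (rank s) = odd_perm s.
Proof. by rewrite /rank oddB ?card_porbits_le. Qed.

Lemma porbit_step s a : s a \in porbit s a.
Proof. by have := mem_porbit s 1 a; rewrite expg1. Qed.

Lemma porbit_trans s : transitive (fun a b => b \in porbit s a).
Proof.
by move=> b a c; rewrite -!eq_porbit_mem => /eqP <- /eqP <-.
Qed.

Lemma porbit_sub_closed s Z a b :
  (forall c, c \in Z -> s c \in Z) -> a \in Z -> b \in porbit s a -> b \in Z.
Proof.
move=> sZ aZ /porbitP[i ->].
elim: i => [|i IH]; first by rewrite expg0 perm1.
by rewrite expgSr permM sZ.
Qed.

Lemma porbit_fix s a b : s a = a -> b \in porbit s a -> b = a.
Proof.
move=> sa /(porbit_sub_closed (Z := [set a])) H.
by apply/set1P/H; rewrite ?inE // => c /set1P ->; rewrite sa inE.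
Qed.

Lemma porbit_conj s t a : porbit (s ^ t) (t a) = t @: porbit s a.
Proof.
apply/setP => b; apply/porbitP/imsetP.
  move=> [i ->]; exists ((s ^+ i) a); first exact: mem_porbit.
  by rewrite -conjXg permJ.
move=> [c /porbitP[i ->] ->]; exists i.
by rewrite -conjXg permJ.
Qed.

Lemma porbits_conj s t : porbits (s ^ t) = [set t @: (C : {set T}) | C in porbits s].
Proof.
apply/setP => C; apply/imsetP/imsetP.
  move=> [a _ ->]; exists (porbit s (t^-1 a)); first exact: imset_f.
  by rewrite -porbit_conj permKV.
move=> [_ /imsetP[a _ ->] ->]; exists (t a) => //.
by rewrite porbit_conj.
Qed.

Lemma rankJ s t : rank (s ^ t) = rank s.
Proof.
rewrite /rank porbits_conj card_imset //.
exact/imset_inj/perm_inj.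
Qed.

Lemma rank1 : rank (1 : {perm T}) = 0.
Proof.
rewrite /rank card_imset ?subnn // => a b /eqP.
by rewrite eq_porbit_mem => /porbit_fix; apply; rewrite perm1.
Qed.

Lemma rankC s t : rank (s * t) = rank (t * s).
Proof. by rewrite -(rankJ (s * t) s) /conjg mulgA mulKg. Qed.

(** The booleans on both sides let one equation cover joining (+1), splitting (-1) and [a = b] (0)
    without truncated subtraction. *)
Lemma rankMtperm s a b : 
  rank (s * tperm a b) + (a != b) = rank s + (a \notin porbit s b).*2.
Proof.
rewrite rankC; have := porbits_mul_tperm s a b => /=.
have := porbits_rank s; have := porbits_rank (tperm a b * s).
move: (_ != _) (_ \notin _) #|porbits s| #|porbits _| => u v m n.
lia.
Qed.

Lemma rank_join s a b : a \notin porbit s b -> rank (s * tperm a b) = (rank s).+1.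
Proof.
move=> ab; have := rankMtperm s a b; rewrite ab.
have -> : a != b by apply: contraNneq ab => ->; rewrite porbit_id.
lia.
Qed.

Lemma rank_split s a b :
  a != b -> a \in porbit s b -> rank s = (rank (s * tperm a b)).+1.
Proof. by move=> nab ab; have := rankMtperm s a b; rewrite nab ab /=; lia. Qed.

Lemma mulg_tpermK s a b : s * tperm a b * tperm a b = s.
Proof. by rewrite -mulgA tperm2 mulg1. Qed.

(** Were [a] and [b] still apart, a second multiplication by [tperm a b] would raise the rank again,
    but it gives back [s]. *)
Lemma porbit_join s a b : a \notin porbit s b -> a \in porbit (s * tperm a b) b.
Proof.
move=> ab; apply/negPn/negP => /rank_join.
by rewrite mulg_tpermK (rank_join ab); lia.
Qed.

Lemma porbit_split s a b :
  a != b -> a \in porbit s b -> a \notin porbit (s * tperm a b) b.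
Proof.
move=> nab ab; apply/negP => /(rank_split nab).
by rewrite mulg_tpermK {1}(rank_split nab ab); lia.
Qed.

Lemma porbit_mono s t : (forall a, s a \in porbit t a) ->
  forall a b, b \in porbit s a -> b \in porbit t a.
Proof.
move=> st a b; apply: porbit_sub_closed (porbit_id _ _) => c ca.
exact: porbit_trans ca (st c).
Qed.

Lemma porbit_join_sub s a b : a \notin porbit s b ->
  forall p q, q \in porbit s p -> q \in porbit (s * tperm a b) p.
Proof.
move=> ab; apply: porbit_mono => c.
have ab' := porbit_join ab; rewrite porbit_sym in ab'.
have := porbit_step (s * tperm a b) c; rewrite permM.
case: tpermP => // [-> | ->] H.
  by apply: porbit_trans H _; rewrite porbit_sym.
exact: porbit_trans H ab'.
Qed.

Lemma porbit_mul_tperm_sub s a b p q : q \in porbit (s * tperm a b) p ->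
  q \in porbit s p \/
  (p \in porbit s a :|: porbit s b) /\ (q \in porbit s a :|: porbit s b).
Proof.
move=> pq; set U := _ :|: _.
have [pU|pU] := boolP (p \in U); [right; split => // | left].
  apply: porbit_sub_closed pU pq => c cU.
  rewrite permM; case: tpermP => [_|_|_ _]; rewrite /U ?inE ?porbit_id ?orbT //.
  move: cU; rewrite /U !inE => /orP[] /porbit_trans H; apply/orP; [left|right];
  exact/H/porbit_step.
apply: porbit_sub_closed (porbit_id s p) pq => c pc; rewrite permM.
have psc : s c \in porbit s p by exact: porbit_trans pc (porbit_step s c).
by rewrite tpermD //; apply: contraNneq pU => E; rewrite /U E !inE [p \in porbit s (s c)]porbit_sym psc ?orbT.
Qed.

Lemma perm_neq1 s : s != 1 -> exists a, s a != a.
Proof.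
move=> s1; apply/existsP; apply: contraR s1; rewrite negb_exists => /forallP H.
by apply/eqP/permP => a; have := H a; rewrite negbK perm1 => /eqP.
Qed.

Lemma rank_fix_tperm s a : s a != a -> rank s = (rank (s * tperm a (s a))).+1.
Proof.
move=> sa; apply: rank_split; first by rewrite eq_sym.
by rewrite porbit_sym porbit_step.
Qed.

Lemma rank_eq0 s : (rank s == 0) = (s == 1).
Proof.
apply/eqP/eqP => [|->]; last exact: rank1.
have [//|/perm_neq1[a sa]] := eqVneq s 1.
by rewrite (rank_fix_tperm sa).
Qed.

Lemma rank_eq1P s : rank s = 1%N -> exists a b, a != b /\ s = tperm a b.
Proof.
move=> s1; have /perm_neq1[a sa] : s != 1 by rewrite -rank_eq0 s1.
exists a, (s a); split; first by rewrite eq_sym.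
have := rank_fix_tperm sa; rewrite s1 => -[/esym/eqP].
rewrite rank_eq0 => /eqP H.
by rewrite -[LHS](mulg_tpermK _ a (s a)) H mul1g.
Qed.

Lemma rank_tperm a b : a != b -> rank (tperm a b) = 1%N.
Proof.
move=> ab; rewrite -[tperm a b]mul1g rank_join ?rank1 //.
by apply: contra ab => /porbit_fix ->; rewrite // perm1.
Qed.

Lemma rank_factor s : exists l : seq {perm T},
  [/\ all (fun u => rank u == 1%N) l, \prod_(u <- l) u = s & size l = rank s].
Proof.
move: {2}(rank s) (leqnn (rank s)) => n; elim: n s => [|n IH] s sn.
  exists [::]; split; rewrite ?big_nil //.
    by apply/esym/eqP; rewrite -rank_eq0 -leqn0.
  by apply/esym/eqP; rewrite -leqn0.
have [->|/perm_neq1[a sa]] := eqVneq s 1.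
  by exists [::]; split; rewrite ?big_nil ?rank1.
have E := rank_fix_tperm sa.
have [|l [l1 l2 l3]] := IH (s * tperm a (s a)); first by rewrite -ltnS -E.
exists (rcons l (tperm a (s a))); split.
- by rewrite all_rcons l1 rank_tperm // eq_sym.
- by rewrite big_rcons /= l2 mulg_tpermK.
- by rewrite size_rcons l3 E.
Qed.

Lemma rank_mul_le s t : rank (s * t) <= rank s + rank t.
Proof.
move: {2}(rank t) (leqnn (rank t)) => n; elim: n t => [|n IH] t.
  by rewrite leqn0 rank_eq0 => /eqP ->; rewrite mulg1 leq_addr.
have [->|/perm_neq1[a ta]] := eqVneq t 1; first by rewrite mulg1 leq_addr.
have E := rank_fix_tperm ta; rewrite E ltnS => /IH.
rewrite mulgA => H.
have := rankMtperm (s * t * tperm a (t a)) a (t a); rewrite mulg_tpermK.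
rewrite eq_sym ta addn1.
by move: H; case: (_ \notin _) => /=; rank_lia.
Qed.

(* When the ranks add up, multiplying by a minimal factorization of [t] into
   transpositions joins two cycles at each step. *)
Lemma porbit_additive s t : rank (s * t) = (rank s + rank t)%N ->
  forall p q, q \in porbit s p -> q \in porbit (s * t) p.
Proof.
move: {2}(rank t) (leqnn (rank t)) => n; elim: n t => [|n IH] t.
  by rewrite leqn0 rank_eq0 => /eqP ->; rewrite mulg1.
have [->|/perm_neq1[a ta]] := eqVneq t 1; first by rewrite mulg1.
have E := rank_fix_tperm ta; rewrite E ltnS => /IH H st p q pq.
have := rank_mul_le s (t * tperm a (t a)) => le.
have := rankMtperm (s * (t * tperm a (t a))) a (t a).
rewrite mulgA mulg_tpermK eq_sym ta addn1 st => F.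
have ab : a \notin porbit (s * t * tperm a (t a)) (t a).
  by move: F le; rewrite mulgA; case: (_ \notin _) => //=; rank_lia.
rewrite -(mulg_tpermK (s * t) a (t a)).
apply: (porbit_join_sub ab); rewrite -mulgA; apply: H => //.
by move: F; rewrite ab /= mulgA; rank_lia.
Qed.

(** When [P] is the support of a cycle [x], this is equivalent to additivity of the rank on [s * x],
    by [rank_separated] and [cycle_separated]. *)
Definition separated (s : {perm T}) (P : {set T}) :=
  forall a b, a \in P -> b \in P -> b \in porbit s a -> a = b.

(* The first return map of [s * t] to [P] is [t]. *)
Lemma porbit_separated s t P : separated s P ->
  (forall a, a \notin P -> t a = a) ->
  forall a b, a \in P -> b \in P -> b \in porbit (s * t) a -> b \in porbit t a.
Proof.
move=> sP tP a b aP bP ab.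
(* [Z] is the union of the [s]-cycles through those points of [P] that lie in the [t]-cycle of [a].
   Separation makes it stable under [s * t] and confines its points in [P] to that [t]-cycle. *)
pose Z := [set c | [exists e in P, (e \in porbit t a) && (c \in porbit s e)]].
have : b \in Z.
  apply: porbit_sub_closed ab => [c|]; last first.
    by rewrite inE; apply/existsP; exists a; rewrite aP !porbit_id.
  rewrite !inE => /existsP[e /and3P[eP ae ec]]; rewrite permM.
  have esc := porbit_trans ec (porbit_step s c).
  have [scP|scP] := boolP (s c \in P); last first.
    by rewrite tP //; apply/existsP; exists e; rewrite eP ae.
  rewrite -(sP _ _ eP scP esc) {scP esc}.
  apply/existsP; exists (t e); rewrite porbit_id (porbit_trans ae (porbit_step t e)) !andbT.
  apply/negPn/negP => teP.
  have /perm_inj te := tP _ teP.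
  by rewrite te eP in teP.
rewrite inE => /existsP[e /and3P[eP ae eb]].
by rewrite -(sP _ _ eP bP eb).
Qed.

(** Peel [tperm a (t a)] off [t]. Its two points lie in [P] and in different cycles of what is left
    of [t], hence, by [porbit_separated], in different cycles of the remaining product. Putting it
    back therefore joins cycles. *)
Lemma rank_separated s t P : separated s P ->
  (forall a, a \notin P -> t a = a) -> rank (s * t) = (rank s + rank t)%N.
Proof.
move=> sP.
move: {2}(rank t) (leqnn (rank t)) => n; elim: n t => [|n IH] t.
  by rewrite leqn0 rank_eq0 => /eqP ->; rewrite mulg1 rank1 addn0.
have [->|/perm_neq1[a ta]] := eqVneq t 1; first by rewrite mulg1 rank1 addn0.
have E := rank_fix_tperm ta; rewrite E ltnS => /IH H tP.
have aP : a \in P by apply: contraNT ta => /tP ->.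
have taP : t a \in P by apply: contraNT ta => /tP/perm_inj ->.
have tP' c : c \notin P -> (t * tperm a (t a)) c = c.
  by move=> cP; rewrite permM (tP c) // tpermD //; apply: contraNneq cP => <-.
have {}H := H tP'.
have ab : a \notin porbit (s * (t * tperm a (t a))) (t a).
  apply/negP => /(porbit_separated sP tP' taP aP).
  apply/negP/porbit_split; first by rewrite eq_sym.
  by rewrite porbit_sym porbit_step.
by have := rank_join ab; rewrite H mulgA mulg_tpermK addnS.
Qed.

(** * Supports and single cycles *)

Definition supp s := [set a | s a != a].

Definition is_cycle s := [exists p, (s p != p) && (supp s \subset porbit s p)].

Lemma suppJ s t : supp (s ^ t) = t @: supp s.
Proof.
apply/setP => a; rewrite -[a](permKV t) mem_imset; last exact: perm_inj.
by rewrite !inE permJ (inj_eq perm_inj).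
Qed.

Lemma supp_step s a : (s a \in supp s) = (a \in supp s).
Proof. by rewrite !inE (inj_eq perm_inj). Qed.

Lemma is_cycleP s a b : is_cycle s -> a \in supp s -> b \in supp s -> b \in porbit s a.
Proof.
move=> /existsP[p /andP[_ /subsetP H]] /H pa /H pb.
by apply: porbit_trans pb; rewrite porbit_sym.
Qed.

Lemma is_cycle_supp s : is_cycle s -> exists a, a \in supp s.
Proof. by move=> /existsP[p /andP[sp _]]; exists p; rewrite inE. Qed.

Lemma is_cycleJ s t : is_cycle s -> is_cycle (s ^ t).
Proof.
move=> /existsP[p /andP[sp sS]]; apply/existsP; exists (t p).
by rewrite permJ (inj_eq perm_inj) sp suppJ porbit_conj imsetS.
Qed.

Lemma not_supp s a : a \notin supp s -> s a = a.
Proof. by rewrite inE negbK => /eqP. Qed.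

Lemma porbit_supp s a b : a != b -> b \in porbit s a -> a \in supp s.
Proof. by move=> ab ba; apply: contraNT ab => /not_supp/porbit_fix/(_ ba) ->. Qed.

(** If [a] and [b] were in the support of [x] and in one cycle of [s], inserting [tperm a b] twice
    between [s] and [x] would lower the rank of both factors, against subadditivity. *)
Lemma cycle_separated s x : is_cycle x -> rank (s * x) = (rank s + rank x)%N ->
  separated s (supp x).
Proof.
move=> xc sx a b aS bS ab; apply/eqP/negPn/negP => nab.
have E : rank x = (rank (tperm a b * x)).+1.
  by rewrite rankC; apply: rank_split => //; apply: is_cycleP.
have F : rank s = (rank (s * tperm a b)).+1.
  by apply: rank_split => //; rewrite porbit_sym.
have := rank_mul_le (s * tperm a b) (tperm a b * x).
by rewrite mulgA mulg_tpermK sx E F; rank_lia.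
Qed.

End PermRank.

(** * Braid equivalence of lists of permutations *)

Section BraidLists.
Local Open Scope group_scope.
Variable T : finType.
Notation G := {perm T}.
Implicit Types (s t x y z g : G) (l r : seq G) (a b c p q : T) (Z : {set T}).

(** The orbit relation of the braid group, generated by the half-twist of [braid_move]. Lists,
    unlike tuples, can be cut and concatenated. *)
Inductive braid : seq G -> seq G -> Prop :=
| braid_refl l : braid l l
| braid_swap l x y r : braid (l ++ x :: y :: r) (l ++ y :: x ^ y :: r)
| braid_sym l r : braid l r -> braid r l
| braid_trans l1 l2 l3 : braid l1 l2 -> braid l2 l3 -> braid l1 l3.

Definition prodl l := \prod_(x <- l) x.

Lemma prodl_nil : prodl [::] = 1. Proof. exact: big_nil. Qed.
Lemma prodl_cons x l : prodl (x :: l) = x * prodl l. Proof. exact: big_cons. Qed.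
Lemma prodl_cat l r : prodl (l ++ r) = prodl l * prodl r. Proof. exact: big_cat. Qed.
Definition prodlE := (prodl_cat, prodl_cons, prodl_nil).

Lemma braid_ctx l1 l2 l r : braid l r -> braid (l1 ++ l ++ l2) (l1 ++ r ++ l2).
Proof.
elim=> [{}l|{}l x y {}r|{}l {}r _|{}l {}r l3 _ H1 _]; [exact: braid_refl| |exact: braid_sym|exact: braid_trans].
by rewrite -!catA !cat_cons !(catA l1 l); exact: braid_swap.
Qed.

Lemma braid_catl l1 l r : braid l r -> braid (l1 ++ l) (l1 ++ r).
Proof. by move=> /(braid_ctx l1 [::]); rewrite !cats0. Qed.

Lemma braid_catr l2 l r : braid l r -> braid (l ++ l2) (r ++ l2).
Proof. exact: (braid_ctx [::]). Qed.

Lemma braid_cons x l r : braid l r -> braid (x :: l) (x :: r).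
Proof. exact: (braid_catl [:: x]). Qed.

Lemma braid_prodl l r : braid l r -> prodl l = prodl r.
Proof.
elim=> [||//|] //; last by move=> ? ? ? _ -> _.
by move=> {}l x y {}r; rewrite !prodlE conjgE !mulgA mulgK.
Qed.

Lemma braid_size l r : braid l r -> size l = size r.
Proof.
elim=> [||//|] //; last by move=> ? ? ? _ -> _.
by move=> {}l x y {}r; rewrite !size_cat /=.
Qed.

Lemma braid_all (P : pred G) : (forall x y, P (x ^ y) = P x) ->
  forall l r, braid l r -> all P l = all P r.
Proof.
move=> PJ l r; elim=> [||//|] //; last by move=> ? ? ? _ -> _.
by move=> {}l x y {}r; rewrite !all_cat /= PJ; case: (P x); case: (P y).
Qed.

Definition transp l := all (fun x => rank x == 1%N) l.

Lemma braid_transp l r : braid l r -> transp l = transp r.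
Proof. by apply: braid_all => x y; rewrite rankJ. Qed.

Lemma braid_swapV x y r : braid (x :: y :: r) (y ^ x^-1 :: x :: r).
Proof.
apply: braid_sym; have := braid_swap [::] (y ^ x^-1) x r.
by rewrite conjgKV.
Qed.

Lemma braid_right x l : braid (x :: l) (rcons l (x ^ prodl l)).
Proof.
elim: l x => [|y l IH] x; first by rewrite prodl_nil conjg1; exact: braid_refl.
apply: braid_trans (braid_swap [::] x y l) _ => /=.
by rewrite prodl_cons conjgM; exact/braid_cons/IH.
Qed.

Lemma braid_left x l r : exists l', braid (l ++ x :: r) (x :: l' ++ r) /\ l' = [seq y ^ x | y <- l].
Proof.
eexists; split; last reflexivity.
elim/last_ind: l r => [|l y IH] r; first exact: braid_refl.
rewrite cat_rcons map_rcons cat_rcons.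
exact: braid_trans (braid_swap _ _ _ _) (IH _).
Qed.

(** The classes are the orbits of the group generated by [l]. Only forward steps are taken; symmetry
    comes from the finite order of each [t]. *)
Definition lconn l : rel T := connect (fun a b => has (fun t => t a == b) l).

Lemma lconn_refl l a : lconn l a a. Proof. exact: connect0. Qed.

Lemma lconn_trans l : transitive (lconn l). Proof. exact: connect_trans. Qed.

Lemma lconn_step l t a : t \in l -> lconn l a (t a).
Proof. by move=> tl; apply: connect1; apply/hasP; exists t. Qed.

Lemma lconn_closed l Z a b : (forall t, t \in l -> forall c, c \in Z -> t c \in Z) ->
  a \in Z -> lconn l a b -> b \in Z.
Proof.
move=> lZ aZ /connectP[p]; elim: p a aZ => [|c p IH] a aZ /=; first by move=> _ ->.
move=> /andP[/hasP[t tl /eqP <-]] /IH; apply; exact: lZ.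
Qed.

Lemma lconn_porbit l t a b : t \in l -> b \in porbit t a -> lconn l a b.
Proof.
move=> tl /(porbit_sub_closed (Z := [set c | lconn l a c])).
rewrite !inE lconn_refl; apply=> // c; rewrite !inE => /lconn_trans; apply.
exact: lconn_step.
Qed.

Lemma lconn_sym l : symmetric (lconn l).
Proof.
suff H a b : lconn l a b -> lconn l b a by move=> a b; apply/idP/idP; exact: H.
move=> /(lconn_closed (Z := [set c | lconn l c a])).
rewrite !inE lconn_refl; apply=> // t tl c; rewrite !inE.
apply: lconn_trans; apply: (lconn_porbit tl).
by rewrite porbit_sym porbit_step.
Qed.

Lemma lconn_sub l r : (forall t, t \in l -> forall a, lconn r a (t a)) ->
  forall a b, lconn l a b -> lconn r a b.
Proof.
move=> lr a b /(lconn_closed (Z := [set c | lconn r a c])).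
rewrite !inE lconn_refl; apply=> // t tl c; rewrite !inE => /lconn_trans; apply.
exact: lr.
Qed.

Lemma lconn_mono l r : {subset l <= r} -> forall a b, lconn l a b -> lconn r a b.
Proof. by move=> lr; apply: lconn_sub => t /lr/lconn_step. Qed.

Lemma lconn_prodl l a : lconn l a (prodl l a).
Proof.
elim: l a => [|x l IH] a; first by rewrite prodl_nil perm1 lconn_refl.
rewrite prodl_cons permM; apply: (@lconn_trans _ (x a)).
  by apply: lconn_step; rewrite mem_head.
by apply: lconn_mono (IH _) => y yl; rewrite inE yl orbT.
Qed.

Lemma lconn_porbit_prodl l a b : b \in porbit (prodl l) a -> lconn l a b.
Proof.
move=> /(porbit_sub_closed (Z := [set c | lconn l a c])).
rewrite !inE lconn_refl; apply=> // c; rewrite !inE => /lconn_trans; apply.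
exact: lconn_prodl.
Qed.

Lemma lconn_V l t a : t \in l -> lconn l a (t^-1 a).
Proof. by move=> tl; apply: (lconn_porbit tl); rewrite -porbitV porbit_step. Qed.

Lemma braid_lconn l r : braid l r -> lconn l =2 lconn r.
Proof.
elim=> [||{}l {}r _ H a b|l1 l2 l3 _ H1 _ H2 a b] //; last by rewrite H1.
move=> {}l x y {}r a b.
set A := l ++ _; set B := l ++ _.
have yA : y \in A by rewrite !(mem_cat, inE) eqxx !orbT.
have xA : x \in A by rewrite !(mem_cat, inE) eqxx !orbT.
have yB : y \in B by rewrite !(mem_cat, inE) eqxx !orbT.
have xB : x ^ y \in B by rewrite !(mem_cat, inE) eqxx !orbT.
have M t : t \in A -> [\/ t = x, t = y | t \in B].
  rewrite !(mem_cat, inE) => /or4P[|/eqP|/eqP|] H; rewrite ?H ?orbT;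
    by [constructor 3 | constructor 1 | constructor 2].
have M' t : t \in B -> [\/ t = x ^ y, t = y | t \in A].
  rewrite !(mem_cat, inE) => /or4P[|/eqP|/eqP|] H; rewrite ?H ?orbT;
    by [constructor 3 | constructor 1 | constructor 2].
apply/idP/idP; apply: lconn_sub => t.
- move=> /M[->|->|tI] c; try exact: lconn_step.
  have -> : x c = y^-1 ((x ^ y) (y c)) by rewrite permJ permK.
  by apply: lconn_trans (lconn_V _ yB); apply: lconn_trans (lconn_step _ xB); exact: lconn_step.
- move=> /M'[->|->|tI] c; try exact: lconn_step.
  have -> : (x ^ y) c = y (x (y^-1 c)) by rewrite -{1}[c](permKV y) permJ.
  by apply: lconn_trans (lconn_step _ yA); apply: lconn_trans (lconn_step _ xA); exact: lconn_V.
Qed.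

(** * Extracting transpositions from a list *)

Lemma tperm_move a b x : rank x = 1%N -> x a = b -> a != b -> x = tperm a b.
Proof.
move=> /rank_eq1P[c [e [ce ->]]]; case: tpermP => [-> ->|-> -> _|_ _ ->] //.
  by rewrite tpermC.
by rewrite eqxx.
Qed.

(** Induction on the length of a simple path from [a] to [b] whose edges are the transpositions of
    [l]. The first edge [t] goes to the front, the induction hypothesis extracts [tperm a b] or
    [tperm v b] from the rest, and one more swap yields [tperm a b] in front. *)
Lemma tperm_first l a b : transp l -> lconn l a b -> a != b ->
  exists l', braid l (tperm a b :: l').
Proof.
move=> + /connectP[p ep eb]; case/shortenP: ep eb => {}p ep up _ eb.
move: {2}(size p) (leqnn (size p)) => n.
elim: n l a p ep up eb => [|n IH] l a [|v p] //=; try by move=> _ _ -> _ _; rewrite eqxx.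
move=> /andP[/hasP[t tl /eqP ta] ep]; rewrite inE negb_or -!andbA => /and4P[nav ap vp up] eb sp trl nab.
have rt : rank t = 1%N by apply/eqP; exact: (allP trl).
have {rt} ta := tperm_move rt ta nav.
case/splitPr: tl trl ep => l1 l2 trl ep.
have [l1' [br El]] := braid_left t l1 l2.
set m := l1' ++ l2 in br.
have trm : transp m by move: trl; rewrite (braid_transp br) /= => /andP[].
case: p => [|u p] in ap vp up sp ep eb *.
  by exists m; rewrite eb /= -ta.
move: ep => /= /andP[/hasP[w wl /eqP wvu] ep].
have bp : b \in u :: p by rewrite eb /= mem_last.
(* Moving [t] to the front conjugates by [t] exactly the elements that stood before it. *)
have sub_m x : x \in l1 ++ t :: l2 -> [\/ x = t, x ^ t \in m | x \in m].
  rewrite /m !(mem_cat, inE) => /or3P[H|/eqP->|->]; rewrite ?orbT; [|by constructor 1|by constructor 3].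
  by constructor 2; rewrite El (map_f (fun y => y ^ t)).
have tE c : c != a -> c != v -> t c = c by move=> ca cv; rewrite ta tpermD // eq_sym.
(* The path is simple, so its later vertices avoid [a] and [v] and are fixed by [t]; edges between
   them survive conjugation by [t]. *)
have key : path (fun a b => has (fun t => t a == b) m) u p.
  elim: p u up {eb bp sp wvu} ap vp ep => [//|c p IHp] u.
  rewrite !cons_uniq !inE !negb_or -!andbA => /and4P[nuc up cp pu] /and3P[au ac ap] /and3P[vu vc vp].
  move=> /= /andP[/hasP[x xl /eqP xu] ep]; apply/andP; split; last first.
    by apply: IHp ep; rewrite ?cons_uniq ?inE ?negb_or ?ac ?vc ?cp ?ap ?vp ?pu.
  have tu : t u = u by apply: tE; rewrite eq_sym.
  have tc : t c = c by apply: tE; rewrite eq_sym.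
  case: (sub_m x xl) => [xt|xm|xm].
  - by rewrite -xu xt tu eqxx in nuc.
  - by apply/hasP; exists (x ^ t) => //; rewrite -{1}tu permJ xu tc.
  - by apply/hasP; exists x => //; rewrite xu.
have [au av] : u != a /\ u != v.
  by move: ap vp; rewrite !inE !negb_or => /andP[? _] /andP[? _]; rewrite ![u == _]eq_sym.
(* The edge from [v] to [u] may have been conjugated by [t], so it now starts at [v] or at [a]. *)
have [e [ee em]] : exists e, (e = a \/ e = v) /\ has (fun t => t e == u) m.
  case: (sub_m w wl) => [wt|wm|wm].
  - by move: au; rewrite -wvu wt ta tpermR eqxx.
  - exists a; split; first by left.
    apply/hasP; exists (w ^ t) => //; rewrite -{1}(tpermR a v) -ta permJ wvu tE //.
  - by exists v; split; [right|apply/hasP; exists w; rewrite // wvu].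
have [||||||l' brl'] := IH m e (u :: p) => //.
- by rewrite /= em.
- by rewrite cons_uniq up andbT; case: ee => ->.
- by apply: contraTneq bp => <-; case: ee => ->.
have {br brl'} br := braid_trans br (braid_cons t brl').
case: ee => ee; subst e.
  by eexists; apply: braid_trans br _; exact: (braid_swap [::]).
exists (t :: l'); apply: braid_trans br _; apply: braid_trans (braid_swapV _ _ _) _.
suff -> : tperm v b ^ t^-1 = tperm a b by exact: braid_refl.
rewrite {1}ta tpermV tpermJ tpermR tpermD //.
by apply: contraTneq bp => <-.
Qed.

Lemma transp_cons a b l : a != b -> transp l -> transp (tperm a b :: l).
Proof. by move=> ab tl; rewrite /transp /= rank_tperm. Qed.

(** Once a copy of [tperm a b] is extracted, the rest has product [tperm a b * prodl l], in which
    the cycles of [a] and [b] are joined. The rest thus still connects [a] to [b] and yields the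
    second copy. *)
Lemma tperm_pair_first l a b : transp l -> lconn l a b -> a \notin porbit (prodl l) b ->
  exists l', braid l (tperm a b :: tperm a b :: l').
Proof.
move=> tl lab ab.
have nab : a != b by apply: contraNneq ab => ->; rewrite porbit_id.
have [l1 br1] := tperm_first tl lab nab.
have tl1 : transp l1 by move: tl; rewrite (braid_transp br1) /= => /andP[].
have E : prodl l1 = tperm a b * prodl l.
  by rewrite (braid_prodl br1) prodl_cons mulgA tperm2 mul1g.
have [|l2 br2] := tperm_first tl1 (a := a) (b := b) _ nab.
  apply: lconn_porbit_prodl; rewrite E porbit_sym.
  have := porbit_join (s := prodl l ^ tperm a b) (a := a) (b := b).
  have -> : prodl l ^ tperm a b * tperm a b = tperm a b * prodl l.
    by rewrite conjgE tpermV -!mulgA tperm2 mulg1.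
  apply; have := porbit_conj (prodl l) (tperm a b) a; rewrite tpermL => ->.
  apply: contra ab => /imsetP[c ca]; rewrite porbit_sym => E'.
  by have -> : b = c by apply: (@perm_inj _ (tperm a b)); rewrite tpermR.
by exists l2; apply: braid_trans br1 _; exact: braid_cons.
Qed.

(* Bring [x] next to [l], run the transposition [t] once around it, and bring
   the result back. *)
Lemma braid_twist pre x R l a b l1 (rho := prodl R) (z := x ^ rho) (t := tperm a b)
    (x' := x ^ (t ^ rho^-1)) :
  braid l (t :: l1) ->
  [/\ braid (pre ++ x :: R ++ l) (pre ++ x' :: R ++ t ^ (z * t) :: l1),
     x' ^ rho = z ^ t
   & prodl (pre ++ x' :: R) = prodl (pre ++ x :: R) * tperm (z a) (z b) * t].
Proof.
move=> bl.
(* [z] is what [x] becomes after passing [R]; this identity lets [z ^ t] travel back through [R] and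
   arrive as [x']. *)
have x'E : x' ^ rho = z ^ t.
  rewrite /x' /z -!conjgM; congr (_ ^ _).
  by rewrite conjgE invgK !mulgA mulgKV.
split=> //.
- apply: braid_catl.
  apply: (@braid_trans _ (x :: R ++ t :: l1)); first exact/braid_cons/braid_catl.
  apply: (@braid_trans _ (R ++ z :: t :: l1)).
    by have := braid_catr (t :: l1) (braid_right x R); rewrite cat_rcons.
  apply: (@braid_trans _ (R ++ t :: z ^ t :: l1)); first exact: braid_swap.
  apply: (@braid_trans _ (R ++ z ^ t :: t ^ (z * t) :: l1)).
    suff -> : t ^ (z * t) = t ^ (z ^ t) by exact: braid_swap.
    have tt : t ^ t^-1 = t by rewrite conjgE invgK mulgV mulg1.
    by rewrite [z ^ t]conjgE !conjgM tt.
  apply: braid_sym; have := braid_catr (t ^ (z * t) :: l1) (braid_right x' R).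
  by rewrite cat_rcons x'E.
- have zE u : u * rho = rho * u ^ rho by rewrite conjgE mulKVg.
  rewrite !prodlE -/rho !zE x'E -/z -tpermJ conjgE tpermV -/t.
  by move: (z) (t) (rho) => ? ? ?; rewrite conjgE !mulgA mulgK.
Qed.

End BraidLists.

(** * Making the transpositions transitive *)

Section MakeTransitive.
Local Open Scope group_scope.
Variable T : finType.
Notation G := {perm T}.
Implicit Types (s t x y z g : G) (l r L R X Tr : seq G) (a b c p q : T) (Z P : {set T}).

(* The points of [P] represent distinct orbits of [L] on which the product is a
   single cycle; appending a transposition destroys at most one such orbit. *)
Lemma leaf_transp L : transp L -> exists P,
  [/\ #|T| <= #|P| + size L, (forall a b, a \in P -> b \in P -> lconn L a b -> a = b)
    & forall p q, p \in P -> lconn L p q -> q \in porbit (prodl L) p].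
Proof.
elim/last_ind: L => [|L t IH].
  have N a b : lconn [::] a b -> a = b.
    move=> /(lconn_closed (Z := [set a])) H.
    by apply/esym/set1P/H => //; rewrite inE.
  move=> _; exists setT; split; first by rewrite cardsT addn0.
    by move=> a b _ _ /N.
  by move=> p q _ /N ->; rewrite porbit_id.
rewrite /transp all_rcons => /andP[/eqP/rank_eq1P[a [b [nab ->]]] /IH[P [cP uP lP]]].
have -> : prodl (rcons L (tperm a b)) = prodl L * tperm a b by rewrite -cats1 !prodlE mulg1.
set w := prodl L in lP *; set L' := rcons _ _.
have L'E t' : t' \in L' -> t' = tperm a b \/ t' \in L.
  by rewrite mem_rcons inE => /orP[/eqP|]; [left|right].
(* [U] is the union of the orbits of [a] and [b], the only ones affected by the new
   transposition. *)
pose U := [set c | lconn L a c || lconn L b c].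
have fixU c : c \notin U -> tperm a b c = c.
  by move=> cU; rewrite tpermD //; apply: contraNneq cU => <-; rewrite inE lconn_refl ?orbT.
have out p q : p \notin U -> lconn L' p q -> lconn L p q.
  move=> pU /(lconn_closed (Z := [set c | lconn L p c])).
  rewrite !inE lconn_refl; apply=> // t' /L'E [->|t'L] c; rewrite !inE => pc.
    rewrite fixU //; apply: contra pU; rewrite !inE.
    by rewrite (lconn_sym L p) in pc => /orP[] /lconn_trans/(_ pc) ->; rewrite ?orbT.
  exact: lconn_trans pc (lconn_step _ t'L).
have inU p q : p \in U -> lconn L' p q -> q \in U.
  apply: lconn_closed => t' /L'E [->|t'L] c cU.
    by case: tpermP => _ //; rewrite ?inE ?lconn_refl ?orbT.
  move: cU; rewrite !inE => /orP[] /lconn_trans H; apply/orP; [left|right];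
  exact/H/lconn_step.
have outl p q : p \in P -> p \notin U -> lconn L' p q -> q \in porbit (w * tperm a b) p.
  move=> pP pU pq.
  apply: (porbit_sub_closed _ (porbit_id _ _) (lP _ _ pP (out _ _ pU pq))) => c pc.
  have := porbit_trans pc (porbit_step (w * tperm a b) c); rewrite permM.
  have [wcU|wcU] := boolP (w c \in U); last by rewrite fixU.
  suff : c \in U.
    move=> cU; move: pU; have -> // : p \in U.
    apply: (inU c) => //; rewrite lconn_sym; apply: lconn_porbit_prodl.
    by rewrite /L' -cats1 !prodlE mulg1.
  have := lconn_prodl L c; rewrite lconn_sym; rewrite inE in wcU => H.
  by rewrite inE; case/orP: wcU => /lconn_trans/(_ H) ->; rewrite ?orbT.
(* If the orbits of [a] and [b] have different representatives, the transposition joins two full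
   cycles into one full cycle, for which [p1] is kept. *)
have [/existsP[p1 /existsP[p2 /and5P[p1P p2P p12 ap1 bp2]]]|] :=
    boolP [exists p1, exists p2, [&& p1 \in P, p2 \in P, p1 != p2, lconn L a p1 & lconn L b p2]].
  have nab' : a \notin porbit w b.
    apply/negP => /lconn_porbit_prodl ba; move: p12; rewrite (uP p1 p2) ?eqxx //.
    rewrite lconn_sym in ap1; apply: lconn_trans ap1 _; rewrite lconn_sym in ba.
    exact: lconn_trans bp2.
  have J := porbit_join_sub nab'.
  exists (P :\ p2); split.
  - by rewrite size_rcons; move: cP; rewrite (cardsD1 p2 P) p2P; lia.
  - move=> c e /setD1P[cp2 cP'] /setD1P[ep2 eP] ce.
    have [cU|cU] := boolP (c \in U); last by apply: (uP) => //; exact: out.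
    have F p : p != p2 -> p \in P -> p \in U -> p = p1.
      move=> pp2 pP; rewrite inE => /orP[H|H]; apply: (uP) => //.
        by rewrite lconn_sym in H; exact: lconn_trans H ap1.
      by move: pp2; rewrite (uP p p2) ?eqxx //; rewrite lconn_sym in H; exact: lconn_trans H bp2.
    by rewrite (F c) // (F e) //; exact: inU ce.
  - move=> p q /setD1P[pp2 pP] pq.
    have [pU|pU] := boolP (p \in U); last exact: outl.
    have qU := inU _ _ pU pq.
    have H c : c \in U -> c \in porbit (w * tperm a b) b.
      rewrite inE => /orP[ac|bc].
        apply: porbit_trans (porbit_join nab') _; apply: J.
        apply: (@porbit_trans _ _ p1); last by apply: (lP _ _ p1P); rewrite lconn_sym in ap1; exact: lconn_trans ac.
        by rewrite porbit_sym; apply: (lP _ _ p1P); rewrite lconn_sym.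
      apply: J; apply: (@porbit_trans _ _ p2); last by apply: (lP _ _ p2P); rewrite lconn_sym in bp2; exact: lconn_trans bc.
      by rewrite porbit_sym; apply: (lP _ _ p2P); rewrite lconn_sym.
    by apply: porbit_trans (H q qU); rewrite porbit_sym; exact: H.
rewrite negb_exists => /forallP H0.
have H p1 p2 : p1 \in P -> p2 \in P -> lconn L a p1 -> lconn L b p2 -> p1 = p2.
  move=> p1P p2P ap1 bp2; apply/eqP; have := H0 p1; rewrite negb_exists => /forallP/(_ p2).
  by rewrite p1P p2P ap1 bp2 !andbT /= negbK.
(* In the other case [U] contains at most one representative, which is given up. *)
exists (P :\: U); split.
- have : #|P :&: U| <= 1.
    apply/card_le1_eqP => p1 p2; rewrite !inE => /andP[p1P /orP[H1|H1]] /andP[p2P /orP[H2|H2]].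
    + by apply: (uP) => //; rewrite lconn_sym in H2; exact: lconn_trans H2 H1.
    + exact/esym/H.
    + exact: H.
    + by apply: (uP) => //; rewrite lconn_sym in H2; exact: lconn_trans H2 H1.
  by rewrite size_rcons; move: cP; rewrite -(cardsID U P); lia.
- by move=> c e /setDP[cP' cU] /setDP[eP eU] /(out _ _ cU); exact: uP.
- by move=> p q /setDP[pP pU]; exact: outl.
Qed.

Lemma factor_list X : exists L, [/\ transp L, size L = sumn (map (@rank T) X), prodl L = prodl X
  & forall a b, lconn X a b -> lconn L a b].
Proof.
elim: X => [|x X [L [L1 L2 L3 L4]]]; first by exists [::].
have [l [l1 l2 l3]] := rank_factor x.
exists (l ++ L); split.
- by rewrite /transp all_cat l1.
- by rewrite size_cat l3 L2.
- by rewrite !prodlE L3 -l2.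
apply: lconn_sub => y; rewrite inE => /orP[/eqP ->|yX] a.
  apply: (@lconn_mono _ l); first by move=> u ul; rewrite mem_cat ul.
  by rewrite -l2; exact: lconn_prodl.
apply: (@lconn_mono _ L); first by move=> u ul; rewrite mem_cat ul orbT.
exact/L4/lconn_step.
Qed.

(** The total rank is the number of transpositions after refining [X], so [leaf_transp] leaves a
    representative. Orbits of [X] are contained in orbits of the refinement, which has the same
    product. *)
Lemma leaf X : sumn (map (@rank T) X) < #|T| ->
  exists p, forall q, lconn X p q -> q \in porbit (prodl X) p.
Proof.
move=> H; have [L [L1 L2 <- L4]] := factor_list X.
have [P [cP _ lP]] := leaf_transp L1.
have /card_gt0P[p pP] : 0 < #|P| by move: cP H; rewrite L2; lia.
by exists p => q /L4; exact: lP.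
Qed.

Definition classes_of X := [seq x ^: [set: G] | x <- X].

Lemma classes_of_conj l x g r : classes_of (l ++ x ^ g :: r) = classes_of (l ++ x :: r).
Proof. by rewrite /classes_of !map_cat /= classGidl ?inE. Qed.

Lemma map_classes (A : Type) (f : G -> A) : (forall x g, f (x ^ g) = f x) ->
  forall X Y, classes_of X = classes_of Y -> map f X = map f Y.
Proof.
move=> fJ; elim=> [|x X IH] [|y Y] //= [xy /IH ->]; congr (_ :: _).
have : x \in y ^: [set: G] by rewrite -xy class_refl.
by case/imsetP => g _ ->.
Qed.

Lemma classes_sumn X Y : classes_of X = classes_of Y ->
  sumn (map (@rank T) X) = sumn (map (@rank T) Y).
Proof. by move=> /map_classes -> // x g; rewrite rankJ. Qed.

Lemma is_cycleJE x g : is_cycle (x ^ g) = is_cycle x.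
Proof. by apply/idP/idP => /is_cycleJ; [move=> /(_ g^-1); rewrite conjgK | apply]. Qed.

Lemma classes_cycles X Y : classes_of X = classes_of Y ->
  all (@is_cycle T) (behead X) = all (@is_cycle T) (behead Y).
Proof.
move=> /(map_classes is_cycleJE) E.
have H (Z : seq G) : all (@is_cycle T) (behead Z) = all id (behead (map (@is_cycle T) Z)).
  by case: Z => //= z Z; rewrite all_map.
by rewrite !H E.
Qed.

(** The last bad element is the useful one: moving it past [r] conjugates it by the product of [r],
    which respects the relevant blocks since all of [r] is good. *)
Lemma split_last (A : Type) (P : pred A) (X : seq A) : has P X ->
  exists (l : seq A) (x : A) (r : seq A), [/\ X = l ++ x :: r, P x & all (predC P) r].
Proof.
elim: X => //= x X IH; have [/IH[l [y [r [-> Py Pr]]]] _|/negbTE XP] := boolP (has P X).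
  by exists (x :: l), y, r.
rewrite ?XP orbF => Px; exists [::], x, X; split=> //.
by rewrite all_predC XP.
Qed.

Definition transitive_list l := forall a b, lconn l a b.

Lemma lconn_conj X z R a : z \in X -> {subset R <= X} -> lconn X a ((z ^ prodl R) a).
Proof.
move=> zX RX; rewrite -{2}[a](permKV (prodl R)) permJ.
have H c : lconn X c (prodl R c) by apply: lconn_mono RX _ _ (lconn_prodl _ _).
apply: (@lconn_trans _ _ ((prodl R)^-1 a)).
  by rewrite lconn_sym -{2}[a](permKV (prodl R)).
by apply: lconn_trans (lconn_step _ zX) (H _).
Qed.

(** One copy of [tperm a b] runs around [z] and returns conjugated; the other stays, so no
    connection of [Tr] is lost. The two together connect [zz a] to [zz b]. *)
Lemma pair_twist pre z R Tr a b (rho := prodl R) (zz := z ^ rho) :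
  transp Tr -> lconn Tr a b -> a \notin porbit (prodl Tr) b ->
  exists z' Tr', [/\ braid (pre ++ z :: R ++ Tr) (pre ++ z' :: R ++ Tr'),
    z' ^ rho = zz ^ tperm a b,
    prodl (pre ++ z' :: R) = prodl (pre ++ z :: R) * tperm (zz a) (zz b) * tperm a b,
    classes_of (pre ++ z :: R) = classes_of (pre ++ z' :: R) &
    [/\ transp Tr', forall p q, lconn Tr p q -> lconn Tr' p q & lconn Tr' (zz a) (zz b)]].
Proof.
move=> tTr ab nab; have [l1 br] := tperm_pair_first tTr ab nab.
have [H1 H2 H3] := braid_twist pre z R br.
set t := tperm a b in H1 H2 H3 br *.
exists (z ^ (t ^ rho^-1)), (t ^ (zz * t) :: t :: l1); split=> //.
  by rewrite classes_of_conj.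
split.
- by move: tTr; rewrite (braid_transp br) /transp /= rankJ.
- move=> p q; rewrite (braid_lconn br); apply: lconn_mono => u.
  by rewrite !inE => /or3P[/eqP ->|/eqP ->|->]; rewrite ?eqxx ?orbT.
- set Tr' := _ :: _.
  have tin : t \in Tr' by rewrite !inE eqxx orbT.
  have tin' : t ^ (zz * t) \in Tr' by rewrite !inE eqxx.
  apply: lconn_trans (lconn_step _ tin) _.
  rewrite lconn_sym; apply: lconn_trans (lconn_step _ tin) _.
  have -> : t (zz b) = (t ^ (zz * t)) (t (zz a)).
    by rewrite -[t (zz b)]permM -[t (zz a)]permM permJ tpermL.
  by rewrite lconn_sym; exact: lconn_step.
Qed.

(* By [leaf], some orbit of [Tr] contains an orbit of [X] on which the product is
   a single cycle. If this [Tr]-orbit is moved by [z \in X], then twisting [z]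
   around a pair of transpositions joins it to another one. *)
Lemma make_transitive X Tr : transp Tr -> transitive_list (X ++ Tr) ->
  prodl (X ++ Tr) = 1 -> sumn (map (@rank T) X) < #|T| ->
  exists X' Tr', [/\ braid (X ++ Tr) (X' ++ Tr'), classes_of X = classes_of X',
    transp Tr' & transitive_list Tr'].
Proof.
(* The number of connected pairs of points, which every twist below increases. *)
pose mu l := #|[set ab : T * T | lconn l ab.1 ab.2]|.
have mu_le l : mu l <= #|{: T * T}| by exact: max_card.
move: {2}(#|{: T * T}| - mu Tr) (leqnn (#|{: T * T}| - mu Tr)) => n.
elim: n X Tr => [|n IH] X Tr.
  move=> H tTr _ _ _; exists X, Tr; split=> //; first exact: braid_refl.
  have : [set ab : T * T | lconn Tr ab.1 ab.2] == setT.
    by rewrite eqEcard subsetT cardsT; move: H; rewrite leqn0 subn_eq0.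
  by move=> /eqP/setP E a b; have := E (a, b); rewrite !inE.
move=> Hn tTr tXT p1 sX.
have [p lp] := leaf sX.
pose B := [set q | lconn Tr p q].
have pB : p \in B by rewrite inE lconn_refl.
have TrB t : t \in Tr -> forall c, c \in B -> t c \in B.
  by move=> tTr' c; rewrite !inE => /lconn_trans; apply; exact: lconn_step.
pose bad (z : G) := ~~ [forall c in B, z c \in B].
have [/split_last[pre [z [R [XE zbad /allP Rgood]]]]|good] := boolP (has bad X); last first.
  exists X, Tr; split=> //; first exact: braid_refl.
  have all_B q : q \in B.
    apply: lconn_closed pB (tXT p q) => t; rewrite mem_cat => /orP[tX c cB|]; last exact: TrB.
    move: good; rewrite -all_predC => /allP/(_ t tX) /=.
    by rewrite negbK => /forall_inP/(_ c cB).
  move=> a b; have := all_B a; have := all_B b; rewrite !inE => pb; rewrite lconn_sym => pa.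
  exact: lconn_trans pb.
have {}Rgood c : c \in B -> prodl R c \in B.
  have {}Rgood t : t \in R -> forall c, c \in B -> t c \in B.
    by move=> /Rgood /=; rewrite negbK => /forall_inP H e /H.
  by move=> cB; apply: lconn_closed cB (lconn_prodl _ _).
have RgoodV c : prodl R c \in B -> c \in B.
  move=> H; apply: (porbit_sub_closed Rgood H).
  by rewrite porbit_sym porbit_step.
move: zbad; rewrite /bad negb_forall_in => /existsP[c /andP[cB zcB]].
set rho := prodl R in Rgood RgoodV; set zz := z ^ rho.
have RX : {subset R <= X} by move=> t tR; rewrite XE mem_cat inE tR !orbT.
have zX : z \in X by rewrite XE mem_cat mem_head orbT.
have zzX q : lconn X q (zz q) by exact: lconn_conj.
have vE : prodl Tr = (prodl X)^-1 by apply/esym/eqP; rewrite eq_invg_mul -prodl_cat p1.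
(* [prodl X] and [prodl Tr] are inverse to each other and have the same cycles, so the cycle of [p]
   lies in [B]. By the choice of [p] this cycle is its whole orbit under [X], hence contains
   [zz p]. *)
have wB q : q \in porbit (prodl X) p -> q \in B.
  by rewrite -porbitV -vE inE; exact: lconn_porbit_prodl.
have zzp : zz p \in B by apply/wB/lp.
have zzc : zz (rho c) \notin B by rewrite permJ; apply: contra zcB => /RgoodV.
have lpc : lconn Tr p (rho c) by have := Rgood c cB; rewrite inE.
(* If [p] and [rho c] shared a cycle of [prodl X], then [zz (rho c)] would be in the orbit of [p]
   under [X], hence in [B]. *)
have npc : p \notin porbit (prodl Tr) (rho c).
  rewrite porbit_sym vE porbitV; apply: contra zzc => /lconn_porbit_prodl pc.
  by apply/wB/lp; apply: lconn_trans pc (zzX _).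
have [z' [Tr' [br _ _ cl [tTr' sub cc]]]] := pair_twist pre z R tTr lpc npc.
have {}br : braid (X ++ Tr) ((pre ++ z' :: R) ++ Tr') by rewrite XE -!catA.
have [||||X2 [Tr2 [H1 H2 H3 H4]]] := IH (pre ++ z' :: R) Tr' _ tTr'.
- suff : mu Tr < mu Tr' by have := mu_le Tr'; lia.
  apply: proper_card; apply/properP; split.
    by apply/subsetP => -[a b]; rewrite !inE; exact: sub.
  exists (zz p, zz (rho c)); rewrite inE //=.
  apply: contra zzc; rewrite inE in zzp; rewrite inE; exact: lconn_trans.
- by move=> a b; rewrite -(braid_lconn br).
- by rewrite -(braid_prodl br).
- by rewrite -(classes_sumn cl) -XE.
exists X2, Tr2; split=> //; first exact: braid_trans br H1.
by rewrite XE cl.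
Qed.

End MakeTransitive.

(** * Raising the rank of the product *)

Section RaiseRank.
Local Open Scope group_scope.
Variable T : finType.
Notation G := {perm T}.
Implicit Types (s t x y z g : G) (l r L R X Tr : seq G) (a b c p q : T) (Z P : {set T}).

(* For [z := f] twisted around [tperm a b], the product [w] is multiplied by two
   transpositions; both of them join cycles. *)
Lemma two_joins w (f : G) : 2 < #|porbits w| -> (exists p, f p \notin porbit w p) ->
  exists a b, f a \notin porbit w (f b) /\ a \notin porbit (w * tperm (f a) (f b)) b.
Proof.
move=> w3 [p fp]; pose Q a := porbit w a.
have QE a b : (Q a == Q b) = (a \in porbit w b) by exact: eq_porbit_mem.
suff [a [b [Qab Qf H1 H2]]] : exists a b, [/\ Q a != Q b, Q (f a) != Q (f b),
    ~~ ((Q a == Q (f a)) && (Q b == Q (f b))) & ~~ ((Q a == Q (f b)) && (Q b == Q (f a)))].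
  exists a, b; rewrite -QE; split => //; apply/negP => /porbit_mul_tperm_sub.
  rewrite -QE (negbTE Qab) => -[//|]; rewrite !inE -!QE => -[/orP[ba|ba] /orP[aa|aa]].
  - by rewrite (eqP aa) (eqP ba) eqxx in Qab.
  - by move: H2; rewrite aa ba.
  - by move: H1; rewrite aa ba.
  - by rewrite (eqP aa) (eqP ba) eqxx in Qab.
suff: [exists a, exists b, [&& Q a != Q b, Q (f a) != Q (f b),
    ~~ ((Q a == Q (f a)) && (Q b == Q (f b))) & ~~ ((Q a == Q (f b)) && (Q b == Q (f a)))]].
  by move=> /existsP[a /existsP[b /and4P[? ? ? ?]]]; exists a, b.
apply: contraT => N.
(* If no pair works, then as soon as [f] moves [a] to another cycle, it sends every third cycle into
   that of [f a]. From [p] and a third cycle, that of [c], it follows that [f] sends all points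
   outside the cycle of [f p] into it. So [f^-1 c] lies in it, and the same principle at [f^-1 c]
   puts [f p] into the cycle of [c], a contradiction. *)
have {}N a b : Q a != Q (f a) -> Q b != Q a -> Q b != Q (f a) -> Q (f b) = Q (f a).
  move=> n1 n2 n3; apply/eqP/negPn/negP => n4; move/negP: N; apply.
  apply/existsP; exists a; apply/existsP; exists b.
  by rewrite (negbTE n1) (negbTE n3) andbF [Q a == _]eq_sym n2 eq_sym n4.
have pfp : Q p != Q (f p) by rewrite eq_sym QE.
have [c pc fpc] : exists2 c, Q c != Q p & Q c != Q (f p).
  have : 0 < #|porbits w :\: [set Q p; Q (f p)]|.
    have := cardsID [set Q p; Q (f p)] (porbits w).
    have : #|porbits w :&: [set Q p; Q (f p)]| <= 2.
      by apply: leq_trans (subset_leq_card (subsetIr _ _)) _; rewrite cards2; case: (_ != _).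
    lia.
  move=> /card_gt0P[_ /setDP[/imsetP[c _ ->]]]; rewrite !inE negb_or => /andP[? ?].
  by exists c.
have fc : Q (f c) = Q (f p) by exact: N.
have toB e : Q e != Q (f p) -> Q (f e) = Q (f p).
  move=> ne; have [ec|ec] := eqVneq (Q e) (Q p); last exact: N.
  by rewrite -fc; apply: N; rewrite ?fc // ec eq_sym.
have : Q (f p) = Q c; last by move=> E; rewrite E eqxx in fpc.
have vB : Q (f^-1 c) = Q (f p).
  by apply/eqP; apply: contraNT fpc => /toB; rewrite permKV => ->.
by rewrite -[c](permKV f); apply: N; rewrite ?permKV ?vB // eq_sym.
Qed.

Definition preserves w z := [forall a, z a \in porbit w a].

Lemma preservesP w l : all (preserves w) l -> forall a b, lconn l a b -> b \in porbit w a.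
Proof.
move=> /allP H a b /(lconn_closed (Z := porbit w a)); apply; last exact: porbit_id.
move=> t /H/forallP Ht c ac; exact: porbit_trans ac (Ht c).
Qed.

Lemma prodl_V X Tr : prodl (X ++ Tr) = 1 -> prodl Tr = (prodl X)^-1.
Proof. by move=> p1; apply/esym/eqP; rewrite eq_invg_mul -prodl_cat p1. Qed.

(** The last element moving some point to another cycle of [w] still does so after passing the
    elements behind it, since these preserve the cycles. Then [two_joins] selects a twist for which
    both new factors of the product join cycles. *)
Lemma raise_rank_step X Tr : transp Tr -> transitive_list Tr -> prodl (X ++ Tr) = 1 ->
  2 < #|porbits (prodl X)| -> ~~ all (preserves (prodl X)) X ->
  exists X' Tr', [/\ braid (X ++ Tr) (X' ++ Tr'), classes_of X = classes_of X',
    transp Tr', transitive_list Tr' & rank (prodl X') = (rank (prodl X)).+2].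
Proof.
set w := prodl X => tTr trT p1 w3; rewrite -has_predC => /split_last[pre [z [R [XE /= zbad Rgood]]]].
have {}Rgood : all (preserves w) R by apply: sub_all Rgood => x /=; rewrite negbK.
have rhoP c : prodl R c \in porbit w c by apply: preservesP Rgood _ _ (lconn_prodl _ _).
set zz := z ^ prodl R.
have [|a [b [ab1 ab2]]] := @two_joins w zz w3.
  move: zbad; rewrite negb_forall => /existsP[c zc]; exists (prodl R c).
  rewrite permJ; apply: contra zc => H.
  apply: porbit_trans (rhoP c) _; apply: porbit_trans H _.
  by rewrite porbit_sym.
have nab : a \notin porbit w b.
  by apply: contra ab2; exact: porbit_join_sub.
have [|z' [Tr' [br _ pE cl [tTr' sub _]]]] := pair_twist pre z R tTr (trT a b).
  by rewrite (prodl_V p1) porbitV.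
exists (pre ++ z' :: R), Tr'; split=> //.
- by rewrite XE -!catA.
- by rewrite XE.
- by move=> c e; exact/sub/trT.
rewrite pE -XE -/w -/zz (rank_join ab2) rank_join //.
Qed.

(** A deficit of the whole product must arise at some prefix. It cannot arise at the first element,
    so [pre] is nonempty and [x] belongs to [behead X], where all elements are cycles. *)
Lemma non_additive X : rank (prodl X) < sumn (map (@rank T) X) ->
  exists pre x R, [/\ X = pre ++ x :: R, pre != [::] & rank (prodl pre * x) <> (rank (prodl pre) + rank x)%N].
Proof.
elim/last_ind: X => [|X x IH] //.
rewrite -cats1 map_cat sumn_cat /= addn0 !prodlE mulg1 => H.
have [E|/eqP E] := eqVneq (rank (prodl X * x)) (rank (prodl X) + rank x)%N.
  have [|pre [y [R [-> pre0 N]]]] := IH; first by lia.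
  by exists pre, y, (R ++ [:: x]); rewrite -catA.
exists X, x, [::]; split=> //.
by apply/eqP => X0; apply: E; rewrite X0 prodl_nil rank1 mul1g.
Qed.

(* If all elements of [X] preserve the cycles of [w], a twist that exchanges a
   point of a pure cycle [x] for a point outside its cycle of [w] keeps the rank
   and leads to a list with an element that does not preserve the cycles of the
   new product. *)
Lemma raise_rank X Tr : transp Tr -> transitive_list Tr -> prodl (X ++ Tr) = 1 ->
  all (@is_cycle T) (behead X) ->
  2 < #|porbits (prodl X)| -> rank (prodl X) < sumn (map (@rank T) X) ->
  exists X' Tr', [/\ braid (X ++ Tr) (X' ++ Tr'), classes_of X = classes_of X',
    transp Tr', transitive_list Tr' & rank (prodl X') = (rank (prodl X)).+2].
Proof.
set w := prodl X => tTr trT p1 cX w3 wX.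
have [good|] := boolP (all (preserves w) X); last exact: raise_rank_step.
have goodX := preservesP good.
have [pre [x [R [XE pre0 nadd]]]] := non_additive wX.
have xc : is_cycle x.
  by move: cX; rewrite XE; case: pre pre0 {XE nadd} => //= _ pre _; rewrite all_cat /= => /and3P[].
(* By [rank_separated], failure of additivity forces two points of the support of [x] into one cycle
   of [prodl pre]. *)
have [s [s' [sS s'S ns ss]]] : exists (s s' : T), [/\ s \in supp x, s' \in supp x, s != s' & s' \in porbit (prodl pre) s].
  have [/existsP[s /existsP[s' /and4P[? ? ? ?]]]|N] :=
    boolP [exists s : T, exists s' : T, [&& s \in supp x, s' \in supp x, s != s' & s' \in porbit (prodl pre) s]].
    by exists s, s'.
  case: nadd; apply: (@rank_separated _ _ _ (supp x)); last by move=> a /not_supp.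
  move=> a b aS bS ab; apply/eqP; apply: contraNT N => nab.
  by apply/existsP; exists a; apply/existsP; exists b; rewrite aS bS nab.
set rho := prodl R; set zz := x ^ rho.
set a := rho s; set a' := rho s'.
have zzc : is_cycle zz by exact: is_cycleJ.
have aS : a \in supp zz by rewrite suppJ imset_f.
have a'S : a' \in supp zz by rewrite suppJ imset_f.
have naa : a != a' by rewrite (inj_eq perm_inj).
have [b ab] : exists b, b \notin porbit w a.
  have : 0 < #|porbits w :\ porbit w a| 
    by move: w3; rewrite (cardsD1 (porbit w a)) imset_f // => /ltnW; rewrite add1n ltnS.
  move=> /card_gt0P[C /setD1P[Ca /imsetP[b _ E]]]; exists b.
  by rewrite E eq_porbit_mem in Ca.
have RX : {subset R <= X} by move=> t tR; rewrite XE mem_cat inE tR !orbT.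
have xX : x \in X by rewrite XE mem_cat mem_head orbT.
have zzw c : zz c \in porbit w c by apply/goodX/lconn_conj.
have suppw c : c \in supp zz -> c \in porbit w a.
  move=> /(is_cycleP zzc aS); apply: porbit_sub_closed (porbit_id _ _) => e ae.
  exact: porbit_trans ae (zzw e).
have bS : b \notin supp zz by apply: contra ab; exact: suppw.
have zb : zz b = b by exact: not_supp.
have nab : a \notin porbit (prodl Tr) b by rewrite (prodl_V p1) porbitV porbit_sym.
have [x' [Tr' [br x'E pE cl [tTr' sub _]]]] := pair_twist pre x R tTr (trT a b) nab.
rewrite -/rho -/zz zb -XE -/w in x'E pE; set w' := prodl (pre ++ x' :: R) in pE.
have nzab : zz a \notin porbit w b.
  by rewrite porbit_sym; apply: contra ab => /(porbit_trans (zzw a)).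
have ab1 : a \in porbit (w * tperm (zz a) b) b.
  apply: porbit_trans (porbit_join nzab) _; apply: porbit_join_sub nzab _ _ _.
  by rewrite porbit_sym.
have naeb : a != b by apply: contraNneq ab => <-; exact: porbit_id.
(* The factor [tperm (zz a) b] joins the cycles of [a] and [b]; the factor [tperm a b] then splits
   the result. *)
have rw' : rank w' = rank w.
  by apply: succn_inj; rewrite pE -(rank_split naeb ab1) rank_join.
have nab' : a \notin porbit w' b by rewrite pE porbit_split.
have brX : braid (X ++ Tr) ((pre ++ x' :: R) ++ Tr') by rewrite XE -!catA.
have [||||X2 [Tr2 [H1 H2 H3 H4 H5]]] := @raise_rank_step (pre ++ x' :: R) Tr' tTr'.
- by move=> c e; exact/sub/trT.
- by rewrite -(braid_prodl brX).
- suff : #|porbits w| = #|porbits w'| by move=> <-.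
  by apply: (@addIn (rank w)); rewrite porbits_rank -rw' porbits_rank.
(* In the support of the twisted cycle [b] has taken the place of [a] beside [a'], while [pre] and
   [R] still link [a'] to [a]. If all elements preserved the cycles of [w'], then [a] and [b] would
   share one, but they were just split. *)
- apply/negP => /preservesP good'.
  have x'z c : (zz ^ tperm a b) c \in porbit w' c.
    rewrite -x'E; apply/good'/lconn_conj; first by rewrite mem_cat mem_head orbT.
    by move=> t tR; rewrite mem_cat inE tR !orbT.
  have nba' : b != a' by apply: contraNneq bS => ->.
  have bS' : b \in supp (zz ^ tperm a b).
    by rewrite suppJ -{1}(tpermL a b) imset_f.
  have a'S' : a' \in supp (zz ^ tperm a b).
    by rewrite suppJ -(tpermD naa nba') imset_f.
  have : a' \in porbit w' b.
    apply: porbit_sub_closed (porbit_id _ _) (is_cycleP (is_cycleJ _ zzc) bS' a'S') => e be.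
    exact: porbit_trans be (x'z e).
  move/porbit_trans => H; move/negP: nab'; apply; apply: H.
  apply/good'; rewrite lconn_sym.
  apply: (@lconn_mono _ (pre ++ R)).
    by move=> t; rewrite !mem_cat inE => /orP[]->; rewrite ?orbT.
  have rhoc c : lconn (pre ++ R) c (rho c).
    by apply: (@lconn_mono _ R); [move=> t; rewrite mem_cat orbC => ->|exact: lconn_prodl].
  apply: lconn_trans (rhoc s'); rewrite lconn_sym; apply: lconn_trans (rhoc s).
  rewrite lconn_sym; apply: (@lconn_mono _ pre); first by move=> t; rewrite mem_cat => ->.
  exact: lconn_porbit_prodl.
exists X2, Tr2; split=> //; first exact: braid_trans brX H1.
  by rewrite XE cl.
by rewrite H5 -/w' rw'.
Qed.

(** The rank has the parity of the sign, so the deficit is even and steps of two do not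
    overshoot. *)
Lemma odd_sumn_rank X : odd (sumn (map (@rank T) X)) = odd (rank (prodl X)).
Proof.
elim: X => [|x X IH]; first by rewrite prodl_nil rank1.
by rewrite /= oddD IH prodl_cons !odd_rank odd_permM.
Qed.

Lemma rank_prodl_le X : rank (prodl X) <= sumn (map (@rank T) X).
Proof.
elim: X => [|x X IH]; first by rewrite prodl_nil rank1.
by rewrite prodl_cons /=; apply: leq_trans (rank_mul_le _ _) _; rewrite leq_add2l.
Qed.

Definition forest X := rank (prodl X) = sumn (map (@rank T) X).

Lemma make_forest X Tr : transp Tr -> transitive_list (X ++ Tr) -> prodl (X ++ Tr) = 1 ->
  all (@is_cycle T) (behead X) -> sumn (map (@rank T) X) < #|T| ->
  exists X' Tr', [/\ braid (X ++ Tr) (X' ++ Tr'), classes_of X = classes_of X',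
    transp Tr', transitive_list Tr' & forest X'].
Proof.
move=> tTr tXT p1 cX sX.
have [X1 [Tr1 [br cl {}tTr trT]]] := make_transitive tTr tXT p1 sX.
rewrite (braid_prodl br) in p1; rewrite (classes_cycles cl) in cX; rewrite (classes_sumn cl) in sX.
suff [X' [Tr' [H1 H2 H3 H4 H5]]] : exists X' Tr', [/\ braid (X1 ++ Tr1) (X' ++ Tr'), classes_of X1 = classes_of X',
    transp Tr', transitive_list Tr' & forest X'].
  by exists X', Tr'; split=> //; [exact: braid_trans br H1|rewrite cl].
clear br cl tXT X Tr; rename X1 into X, Tr1 into Tr.
move: {2}(#|T| - rank (prodl X)) (leqnn (#|T| - rank (prodl X))) => n.
elim: n X Tr tTr trT p1 cX sX => [|n IH] X Tr tTr trT p1 cX sX Hn.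
  by have := rank_prodl_le X; lia.
have [F|NF] := eqVneq (rank (prodl X)) (sumn (map (@rank T) X)).
  by exists X, Tr; split=> //; exact: braid_refl.
have lt : (rank (prodl X)).+2 <= sumn (map (@rank T) X).
  have := odd_sumn_rank X; move: NF (rank_prodl_le X).
  by move: (sumn _) (rank _) => u v; lia.
(* The rank of the product is at least two below a total that is less than [#|T|], so more than two
   cycles remain. *)
have [||X1 [Tr1 [H1 H2 H3 H4 H5]]] := raise_rank tTr trT p1 cX.
- by have := porbits_rank (prodl X); lia.
- by lia.
rewrite (braid_prodl H1) in p1; rewrite (classes_cycles H2) in cX; rewrite (classes_sumn H2) in sX.
have [|X' [Tr' [I1 I2 I3 I4 I5]]] := IH X1 Tr1 H3 H4 p1 cX sX.
  by rewrite H5; lia.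
by exists X', Tr'; split=> //; [exact: braid_trans H1 I1|rewrite H2].
Qed.

End RaiseRank.

(** * Lists of transpositions *)

Section Transpositions.
Local Open Scope group_scope.
Variable T : finType.
Notation G := {perm T}.
Implicit Types (s t x y z g v : G) (l L R X Tr D E : seq G) (a b c e p q r : T) (Z P : {set T}).

Lemma transp_cat l L : transp (l ++ L) = transp l && transp L.
Proof. exact: all_cat. Qed.

Lemma rank1_invol s : rank s = 1%N -> s * s = 1.
Proof. by move=> /rank_eq1P[a [b [_ ->]]]; exact: tperm2. Qed.

(** An element passed by both copies is conjugated by [s * s = 1], so a pair moves freely and
    changes nothing. *)
Lemma pair_front s l1 l2 : rank s = 1%N -> braid (l1 ++ s :: s :: l2) (s :: s :: l1 ++ l2).
Proof.
move=> /rank1_invol ss; elim/last_ind: l1 l2 => [|l1 y IH] l2; first exact: braid_refl.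
rewrite !cat_rcons; apply: braid_trans (IH _).
apply: braid_trans (braid_swap _ _ _ _) _.
rewrite -cat_rcons; apply: braid_trans (braid_swap _ _ _ _) _.
by rewrite cat_rcons -conjgM ss conjg1; exact: braid_refl.
Qed.

(** Move the pair next to [h], let [h] pass over both copies, which conjugates them, and move the
    pair back. *)
Lemma pair_conj s h l : rank s = 1%N -> h \in l -> braid (s :: s :: l) (s ^ h :: s ^ h :: l).
Proof.
move=> s1 /splitPr[l1 l2].
apply: braid_trans (braid_sym (pair_front _ _ s1)) _.
have sh1 : rank (s ^ h) = 1%N by rewrite rankJ.
have := pair_front (rcons l1 h) l2 sh1; rewrite !cat_rcons; apply: braid_trans.
rewrite -cat_rcons; apply: braid_trans (braid_swap _ _ _ _) _.
by rewrite cat_rcons; exact: braid_swap.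
Qed.

(** Write [g] as a product of transpositions. As [l] is transitive, each of them can be braided to
    the front of [l], used in [pair_conj], and the braiding of [l] undone. *)
Lemma pair_conj_any s g l : rank s = 1%N -> transp l -> transitive_list l ->
  braid (s :: s :: l) (s ^ g :: s ^ g :: l).
Proof.
move=> s1 tl trl; have [ts -> dts] := prod_tpermP g.
elim: ts s s1 dts => [|[a b] ts IH] s s1.
  by rewrite big_nil conjg1 => _; exact: braid_refl.
rewrite big_cons /= => /andP[ab dts]; rewrite conjgM.
have sab1 : rank (s ^ tperm a b) = 1%N by rewrite rankJ.
apply: braid_trans (IH _ sab1 dts).
have [l' br] := tperm_first tl (trl a b) ab.
have := braid_catl [:: s; s] br; have := braid_catl [:: s ^ tperm a b; s ^ tperm a b] br.
move=> /= /braid_sym H1 H2; apply: braid_trans H2 _; apply: braid_trans H1.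
by apply: pair_conj => //; rewrite mem_head.
Qed.

Lemma rank1_conj s t : rank s = 1%N -> rank t = 1%N -> exists g, s ^ g = t.
Proof.
move=> /rank_eq1P[a [b [ab ->]]] /rank_eq1P[a' [b' [ab' ->]]].
exists (tperm a a' * tperm (tperm a a' b) b').
rewrite tpermJ !permM tpermL; congr tperm; last by rewrite tpermL.
by rewrite tpermD // 1?eq_sym // -{1}(tpermL a a') (inj_eq perm_inj).
Qed.

Lemma pair_change s s' l : rank s = 1%N -> rank s' = 1%N -> transp l -> transitive_list l ->
  braid (s :: s :: l) (s' :: s' :: l).
Proof.
move=> s1 s'1 tl trl.
by have [g <-] := rank1_conj s1 s'1; exact: pair_conj_any.
Qed.

(** * Lists of pairs and the normal form *)

Definition dbl D := flatten [seq [:: s; s] | s <- D].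

Lemma dbl_transp D : transp (dbl D) = transp D.
Proof. by elim: D => //= s D; rewrite /transp /= => ->; case: (_ == _). Qed.

Lemma dbl_mem D s : s \in D -> s \in dbl D.
Proof. by move=> sD; apply/flattenP; exists [:: s; s]; rewrite ?map_f ?mem_head. Qed.

Lemma dbl_memE D s : s \in dbl D -> s \in D.
Proof. by move=> /flattenP[_ /mapP[t tD ->]]; rewrite !inE orbb => /eqP ->. Qed.

Lemma size_dbl D : size (dbl D) = (size D).*2.
Proof. by elim: D => //= s D ->. Qed.

Lemma prodl_dbl D : transp D -> prodl (dbl D) = 1.
Proof.
elim: D => [|s D IH] /=; first by rewrite prodl_nil.
by rewrite /transp /= => /andP[/eqP/rank1_invol ss /IH E]; rewrite !prodl_cons E mulg1.
Qed.

Lemma dbl_front D l : transp D -> braid (l ++ dbl D) (dbl D ++ l).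
Proof.
elim: D => [|s D IH] /=; first by rewrite cats0 => _; exact: braid_refl.
rewrite /transp /= => /andP[/eqP s1 /IH br].
apply: braid_trans (pair_front _ _ s1) _.
exact: (braid_catl [:: s; s]).
Qed.

Lemma transitive_catr l1 l : transitive_list l -> transitive_list (l1 ++ l).
Proof. by move=> H a b; apply: lconn_mono (H a b) => t tl; rewrite mem_cat tl orbT. Qed.

Lemma dbl_change E E' l : transp E -> transp E' -> size E = size E' ->
  transp l -> transitive_list l -> braid (dbl E ++ l) (dbl E' ++ l).
Proof.
move=> + + + tl trl; elim: E E' => [|s E IH] [|s' E'] //=; first by move=> *; exact: braid_refl.
rewrite /transp /= => /andP[/eqP s1 tE] /andP[/eqP s1' tE'] [sE].
apply: (@braid_trans _ _ (s :: s :: dbl E' ++ l)).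
  exact/(braid_catl [:: s; s])/IH.
apply: pair_change => //; last exact: transitive_catr.
by rewrite transp_cat dbl_transp [transp E']tE'.
Qed.

(** [T0] depends on [v] alone. Any list with product [v] connects [a] to [v a], so [tperm a (v a)]
    can be extracted, and the rest has a product of smaller rank. *)
Lemma prefix_factor v : exists T0, [/\ transp T0, size T0 = rank v, prodl T0 = v &
  forall Tr, transp Tr -> prodl Tr = v -> exists T1, braid Tr (T0 ++ T1)].
Proof.
move: {2}(rank v) (leqnn (rank v)) => n; elim: n v => [|n IH] v.
  rewrite leqn0 rank_eq0 => /eqP ->; exists [::]; split; rewrite ?rank1 ?prodl_nil //.
  by move=> Tr _ _; exists Tr; exact: braid_refl.
have [->|/perm_neq1[a va]] := eqVneq v 1.
  move=> _; exists [::]; split; rewrite ?rank1 ?prodl_nil //.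
  by move=> Tr _ _; exists Tr; exact: braid_refl.
have va' : a != v a by rewrite eq_sym.
have := rank_fix_tperm va; rewrite rankC => E; rewrite E ltnS => /IH[T0 [H1 H2 H3 H4]].
exists (tperm a (v a) :: T0); split.
- exact: transp_cons.
- by rewrite /= H2.
- by rewrite prodl_cons H3 mulgA tperm2 mul1g.
- move=> Tr tTr pTr; have [|l br] := tperm_first tTr _ va'.
    by rewrite -pTr; exact: lconn_prodl.
  have tl : transp l by move: tTr; rewrite (braid_transp br) /transp /= => /andP[].
  have [|T1 br1] := H4 l tl.
    have := braid_prodl br; rewrite pTr prodl_cons => pv.
    by apply: (mulgI (tperm a (v a))); rewrite -pv mulgA tperm2 mul1g.
  by exists T1; apply: braid_trans br _; exact: braid_cons.
Qed.

(** The list behind the first element [t] has product [t]; it connects the two points of [t], hence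
    yields a second copy. *)
Lemma prod1_pairs Tr : transp Tr -> prodl Tr = 1 -> exists E, transp E /\ braid Tr (dbl E).
Proof.
move: {2}(size Tr) (leqnn (size Tr)) => n; elim: n Tr => [|n IH] [|t l] //.
- by exists [::]; split=> //; exact: braid_refl.
- by exists [::]; split=> //; exact: braid_refl.
rewrite /= ltnS => sl; rewrite /transp /= prodl_cons => /andP[/eqP t1 tl] pt.
have [a [b [ab tE]]] := rank_eq1P t1.
have pl : prodl l = t by rewrite -[LHS]mul1g -{1}(rank1_invol t1) -mulgA pt mulg1.
have [|l1 br1] := tperm_first tl (a := a) (b := b) _ ab.
  by have := lconn_prodl l a; rewrite pl tE tpermL.
rewrite -tE in br1.
have := braid_size br1 => /= sl1.
have := braid_transp br1; rewrite [transp l]tl /transp /= => /esym/andP[_ tl1].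
have pl1 : prodl l1 = 1.
  by have := braid_prodl br1; rewrite pl prodl_cons -{1}[t]mulg1 => /mulgI.
have [|E [tE' brE]] := IH l1 _ tl1 pl1; first by lia.
exists (t :: E); split; first by rewrite /transp /= t1.
apply: braid_trans (braid_cons _ br1) _.
exact: (braid_catl [:: t; t]).
Qed.

(** Removing pairs leaves the product unchanged. By transitivity the rest connects the next [b] to
    some [e] already reached, and these lie in different cycles of the product, so a pair
    [tperm e b] can be split off. *)
Lemma star_pairs r bs Tr : transp Tr -> transitive_list Tr ->
  uniq (map (porbit (prodl Tr)) (r :: bs)) ->
  exists T1, braid Tr (dbl [seq tperm r b | b <- bs] ++ T1).
Proof.
move=> tTr trT; set v := prodl Tr.
elim: bs => [|b bs IH]; first by exists Tr; exact: braid_refl.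
rewrite /= inE negb_or -andbA => /and4P[rb rbs bbs ubs].
have [|T1 br] := IH; first by rewrite /= rbs.
set D := map _ _ in br.
have tD : transp (dbl D ++ T1) by rewrite -(braid_transp br).
move: tD; rewrite transp_cat => /andP[tD tT1].
have tD' : transp D by rewrite -dbl_transp.
have pT1 : prodl T1 = v by rewrite /v (braid_prodl br) prodl_cat prodl_dbl // mul1g.
have [e er eb] : exists2 e, e \in r :: bs & lconn T1 e b.
  apply/hasP; apply: contraT => /hasPn N.
  pose W := [set c | all (fun e => ~~ lconn T1 e c) (r :: bs)].
  have bW : b \in W by rewrite inE; exact/allP.
  have rW : r \notin W by rewrite inE /= lconn_refl.
  suff : r \in W by rewrite (negbTE rW).
  apply: lconn_closed bW (_ : lconn (dbl D ++ T1) b r); last by rewrite -(braid_lconn br).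
  move=> t; rewrite mem_cat => /orP[/dbl_memE/mapP[b' b'bs ->]|tT] c cW.
    rewrite tpermD //; apply: contraTneq cW => <-; first by [].
    by rewrite inE; apply/allPn; exists b'; rewrite ?inE ?b'bs ?orbT // lconn_refl.
  move: cW; rewrite !inE => /allP H; apply/allP => e /H; apply: contra => H1.
  by apply: lconn_trans H1 _; rewrite lconn_sym; exact: lconn_step.
have neb : e \notin porbit (prodl T1) b.
  rewrite pT1 -eq_porbit_mem; move: er; rewrite inE => /orP[/eqP ->|ebs] //.
  by apply: contra bbs => /eqP <-; exact: map_f.
have [T2 br2] := tperm_pair_first tT1 eb neb.
have ne : e != b by apply: contraNneq neb => ->; exact: porbit_id.
exists T2; apply: braid_trans br _; apply: braid_trans (braid_catl _ br2) _.
apply: braid_trans (pair_front _ _ (rank_tperm ne)) _.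
move: er; rewrite inE => /orP[/eqP -> |ebs]; first exact: braid_refl.
have hD : tperm r e \in dbl D ++ T2.
  by rewrite mem_cat dbl_mem //; apply/mapP; exists e.
(* Conjugation by the available [tperm r e] turns the pair into one centred at [r]. *)
have -> : tperm r b = tperm e b ^ tperm r e.
  rewrite tpermJ tpermR tpermD //.
  by apply: contraNneq rb => ->.
exact: pair_conj (rank_tperm ne) hD.
Qed.

Lemma cycle_reps v r : exists bs, uniq (map (porbit v) (r :: bs)) /\
  forall c, exists2 e, e \in r :: bs & c \in porbit v e.
Proof.
pose rp (C : {set T}) := odflt r [pick x in C].
have rpP c : porbit v (rp (porbit v c)) = porbit v c.
  apply/eqP; rewrite eq_porbit_mem /rp; case: pickP => [x //|/(_ c)].
  by rewrite porbit_id.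
exists [seq rp C | C <- enum (porbits v :\ porbit v r)]; split.
  have E : map (porbit v) [seq rp C | C <- enum (porbits v :\ porbit v r)] = enum (porbits v :\ porbit v r).
    rewrite -map_comp -[RHS]map_id; apply/eq_in_map => C; rewrite mem_enum.
    by move=> /setD1P[_ /imsetP[c _ ->]]; exact: rpP.
  by rewrite map_cons cons_uniq E enum_uniq mem_enum !inE eqxx.
move=> c; have [|cr] := boolP (c \in porbit v r); first by exists r => //; exact: mem_head.
exists (rp (porbit v c)); last by rewrite porbit_sym -eq_porbit_mem rpP.
rewrite inE map_f ?orbT // mem_enum; apply/setD1P; split; last exact: imset_f.
by rewrite eq_porbit_mem.
Qed.

(* Up to braiding, a transitive list of transpositions depends only on its
   product and length: it consists of a minimal factorization of its product,
   pairs joining the cycles of the product, and a number of further pairs. *)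
Lemma transp_normal_form v r : exists base, [/\ transp base, prodl base = v,
  transitive_list base, size base = (rank v + #|porbits v|.-1.*2)%N &
  forall Tr, transp Tr -> transitive_list Tr -> prodl Tr = v ->
    exists E, transp E /\ braid Tr (dbl E ++ base)].
Proof.
have [bs [ubs cov]] := cycle_reps v r.
have [T0 [t0 s0 p0 H0]] := prefix_factor v.
set D := [seq tperm r b | b <- bs].
have tD : transp D.
  apply/allP => _ /mapP[b bbs ->]; rewrite rank_tperm //.
  by move: ubs => /= /andP[+ _]; apply: contraNneq => ->; exact: map_f.
exists (dbl D ++ T0); split.
- by rewrite transp_cat dbl_transp tD.
- by rewrite prodl_cat prodl_dbl // mul1g.
- have H c : lconn (dbl D ++ T0) r c.
    have [e er ec] := cov c.
    apply: (@lconn_trans _ _ e).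
      move: er; rewrite inE => /orP[/eqP ->|ebs]; first exact: lconn_refl.
      rewrite -[X in lconn _ _ X](tpermL r e); apply: lconn_step.
      by rewrite mem_cat dbl_mem //; apply/mapP; exists e.
    apply: (@lconn_mono _ T0); first by move=> t tt; rewrite mem_cat tt orbT.
    by apply: lconn_porbit_prodl; rewrite p0.
  by move=> a b; apply: lconn_trans (H b); rewrite lconn_sym.
- rewrite size_cat s0 size_dbl size_map addnC; congr (_ + _.*2)%N.
  have -> : porbits v = [set C in map (porbit v) (r :: bs)].
    apply/setP => C; rewrite inE; apply/imsetP/mapP => -[c]; last by move=> _ ->; exists c.
    move=> _ ->; have [e er ec] := cov c; exists e => //.
    by apply/eqP; rewrite eq_porbit_mem.
  by rewrite cardsE (card_uniqP _) // size_map.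
- move=> Tr tTr trT pTr.
  have [|T1 br] := star_pairs (r := r) (bs := bs) tTr trT; first by rewrite pTr.
  have := braid_transp br; rewrite tTr transp_cat dbl_transp tD => /esym tT1.
  have := braid_prodl br; rewrite pTr prodl_cat prodl_dbl // mul1g => /esym pT1.
  have [T2 br2] := H0 T1 tT1 pT1.
  have := braid_transp br2; rewrite [transp T1]tT1 transp_cat t0 => /esym tT2.
  have [|E [tE brE]] := prod1_pairs tT2.
    by have := braid_prodl br2; rewrite pT1 prodl_cat p0 -{1}[v]mulg1 => /mulgI.
  exists E; split=> //; apply: braid_trans br _.
  apply: braid_trans (braid_catl _ (braid_trans br2 (braid_catl _ brE))) _.
  by rewrite catA; exact: dbl_front.
Qed.

(** Both lists reduce to the same base preceded by pairs; equal lengths give equally many pairs, and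
    these are interchangeable over a transitive base. *)
Lemma transp_braid Tr Tr' : transp Tr -> transp Tr' -> transitive_list Tr -> transitive_list Tr' ->
  prodl Tr = prodl Tr' -> size Tr = size Tr' -> braid Tr Tr'.
Proof.
case: Tr => [|t l] t1 t2 tr1 tr2 p12 s12.
  by move: s12 => /esym/size0nil ->; exact: braid_refl.
have [r _] : exists r : T, True.
  by move: t1; rewrite /transp /= => /andP[/eqP/rank_eq1P[a _] _]; exists a.
have [base [H1 H2 H3 H4 H5]] := transp_normal_form (prodl Tr') r.
have [E [tE br]] := H5 _ t1 tr1 p12.
have [E' [tE' br']] := H5 _ t2 tr2 erefl.
have sE : size E = size E'.
  have := braid_size br; rewrite s12 (braid_size br') !size_cat !size_dbl.
  by move=> /eqP; rewrite eqn_add2r => /eqP/double_inj.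
apply: braid_trans br _; apply: braid_trans (braid_sym br').
exact: dbl_change.
Qed.

End Transpositions.

(** * Reconfiguring forests *)

Section Reconfigure.
Local Open Scope group_scope.
Variable T : finType.
Notation G := {perm T}.
Implicit Types (s t x y z g v f h : G) (l L R X Tr D E : seq G) (a b c e p q r : T) (Z P S A B : {set T}).

Lemma is_cycle_supp_porbit x p : is_cycle x -> p \in supp x -> supp x = porbit x p.
Proof.
move=> xc pS; apply/setP => a; apply/idP/idP; first exact: is_cycleP.
apply: porbit_sub_closed pS => c; by rewrite supp_step.
Qed.

Lemma rank_cycle x : is_cycle x -> #|supp x| = (rank x).+1.
Proof.
move=> xc; have [p pS] := is_cycle_supp xc.
have SE := is_cycle_supp_porbit xc pS.
have E : porbits x = supp x |: [set [set a] | a in ~: supp x].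
  apply/setP => C; rewrite !inE; apply/imsetP/orP.
    move=> [a _ ->]; have [aS|aS] := boolP (a \in supp x).
      by left; apply/eqP; rewrite (is_cycle_supp_porbit xc aS).
    right; apply/imsetP; exists a; rewrite ?in_setC //.
    by apply/setP => c; rewrite inE; apply/idP/eqP => [/(porbit_fix (not_supp aS))|->]; rewrite ?porbit_id.
  move=> [/eqP ->|/imsetP[a aS ->]]; first by exists p.
  exists a => //; rewrite in_setC in aS.
  by apply/setP => c; rewrite inE; apply/eqP/idP => [->|/(porbit_fix (not_supp aS))]; rewrite ?porbit_id.
have := porbits_rank x; rewrite E cardsU1 card_imset; last exact: set1_inj.
have -> : supp x \notin [set [set a] | a in ~: supp x].
  by apply/imsetP => -[a + Sa]; rewrite Sa !inE eqxx.
have := cardsC (supp x).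
by move: #|supp x| #|~: supp x| (rank x) => u w n /= <-; lia.
Qed.

Lemma perm_onto A B : #|A| = #|B| -> exists h : G, h @: A = B.
Proof.
move: {2}#|A :\: B| (leqnn #|A :\: B|) => n; elim: n A => [|n IH] A.
  rewrite leqn0 cards_eq0 setD_eq0 => AB cAB; exists 1.
  have /eqP -> : A == B by rewrite eqEcard AB cAB leqnn.
  by rewrite -[RHS]imset_id; apply: eq_imset => a; rewrite perm1.
have [AB|/subsetPn[a aA aB] Hn cAB] := boolP (A \subset B).
  by move=> _ ?; apply: IH => //; move: AB; rewrite -setD_eq0 => /eqP ->; rewrite cards0.
have [b bB bA] : exists2 b, b \in B & b \notin A.
  apply/subsetPn; apply/negP => BA; case/negP: aB.
  by have /eqP -> : B == A by rewrite eqEcard BA cAB leqnn.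
have AE : tperm a b @: A = b |: (A :\ a).
  apply/setP => c; rewrite -[c](tpermK a b) mem_imset ?tpermK; last exact: perm_inj.
  rewrite !inE; case: tpermP => [->|->|/eqP ca /eqP cb].
  - by rewrite (negbTE bA) eqxx /=; apply/esym/norP; split; [apply: contraNneq bA => <-|].
  - by rewrite eqxx aA.
  - by rewrite (negbTE ca) (negbTE cb).
have [||h hE] := IH (tperm a b @: A).
- rewrite -ltnS; apply: leq_trans Hn; apply: proper_card; apply/properP; split.
    apply/subsetP => c; rewrite AE !inE => /andP[cB /orP[/eqP cb|/andP[_ ->]]]; last by rewrite cB.
    by rewrite cb bB in cB.
  exists a; first by rewrite !inE aA aB.
  by rewrite AE !inE eqxx /= orbF negb_and orbC; apply/orP; left; apply: contraNneq aB => ->.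
- by rewrite card_imset //; exact: perm_inj.
exists (tperm a b * h); rewrite -hE -imset_comp.
by apply: eq_imset => c; rewrite permM.
Qed.

Lemma prodl_out R P : (forall x, x \in R -> forall a, a \notin P -> x a = a) ->
  forall a, a \notin P -> prodl R a = a.
Proof.
elim: R => [|x R IH] H a aP; first by rewrite prodl_nil perm1.
rewrite prodl_cons permM (H x) ?mem_head //; apply: IH => // y yR; apply: H.
by rewrite inE yR orbT.
Qed.

Lemma forest_in P R : all (@is_cycle T) R -> sumn (map (@rank T) R) < #|P| ->
  exists R', [/\ classes_of R = classes_of R',
    forall x, x \in R' -> forall a, a \notin P -> x a = a & forest R'].
Proof.
elim: R P => [|x R IH] P /=.
  by move=> _ _; exists [::]; split=> //; rewrite /forest prodl_nil rank1.
move=> /andP[xc cR] sP.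
have [S SP cS] : exists2 S : {set T}, S \subset P & #|supp x| = #|S|.
  exists [set a in take #|supp x| (enum P)].
    by apply/subsetP => a; rewrite inE => /mem_take; rewrite mem_enum.
  rewrite [RHS]cardsE (card_uniqP _) ?take_uniq ?enum_uniq // size_take -cardE.
  by case: ltnP => //; rewrite (rank_cycle xc); move: sP; lia.
have [h hS] := perm_onto cS; set x' := x ^ h.
have x'S : supp x' = S by rewrite suppJ.
have [p pS] := is_cycle_supp (is_cycleJ h xc); rewrite x'S in pS.
(* The new cycle uses up all points of [S] but one, that is [rank x] of them; the others may touch
   it only at [p]. *)
pose P' := P :\: (S :\ p).
have cP' : #|P| = (#|P'| + rank x)%N.
  rewrite -(cardsID (S :\ p) P) addnC (setIidPr _); last exact: subset_trans (subsetDl _ _) SP.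
  by congr (_ + _)%N; move: cS; rewrite (rank_cycle xc) (cardsD1 p S) pS => -[].
have [|R' [H1 H2 H3]] := IH P' cR; first by move: sP; rewrite cP'; lia.
exists (x' :: R'); split.
- by rewrite /classes_of /= classGidl ?inE // -!/(classes_of _) H1.
- move=> y; rewrite inE => /orP[/eqP ->|yR] a aP.
    by apply: not_supp; rewrite x'S; apply: contra aP; exact: (subsetP SP).
  by apply: (H2 y) => //; apply: contra aP => /setDP[].
rewrite /forest prodl_cons /= -H3; apply: (@rank_separated _ _ _ P'); last exact: prodl_out.
move=> a b /setDP[_ aS] /setDP[_ bS] ab; apply/eqP; apply: contraT => nab.
have aS' := porbit_supp nab ab; rewrite porbit_sym in ab; rewrite eq_sym in nab.
have bS' := porbit_supp nab ab; rewrite x'S in aS' bS'.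
move: aS bS nab; rewrite !inE aS' bS' !andbT !negbK => /eqP -> /eqP ->.
by rewrite eqxx.
Qed.

Lemma forest_cat X R : forest (X ++ R) -> forest X.
Proof.
rewrite /forest map_cat sumn_cat prodl_cat.
have := rank_mul_le (prodl X) (prodl R); have := rank_prodl_le X; have := rank_prodl_le R.
by rank_lia.
Qed.

Lemma forest_rcons X x : forest (X ++ [:: x]) <->
  forest X /\ rank (prodl X * x) = (rank (prodl X) + rank x)%N.
Proof.
split=> [H|[H1 H2]].
  have F := forest_cat H; split=> //.
  by move: H; rewrite /forest map_cat sumn_cat prodl_cat prodl_cons prodl_nil mulg1 /= addn0 -F.
by rewrite /forest map_cat sumn_cat prodl_cat prodl_cons prodl_nil mulg1 /= addn0 H2 H1.
Qed.

(** By [porbit_additive], cycles of a partial product persist, so the orbits of a forest are the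
    cycles of its product. This makes the complementary transpositions transitive. *)
Lemma forest_conn X : forest X -> forall a b, lconn X a b -> b \in porbit (prodl X) a.
Proof.
elim/last_ind: X => [|X x IH].
  move=> _ a b /(lconn_closed (Z := [set a])) H.
  have /set1P -> : b \in [set a] by apply: H => //; rewrite inE.
  exact: porbit_id.
rewrite -cats1 => F a b /(lconn_closed (Z := porbit (prodl (X ++ [:: x])) a)).
apply; last exact: porbit_id.
have [FX /porbit_additive add] := (forest_rcons X x).1 F.
have pE : prodl (X ++ [:: x]) = prodl X * x by rewrite prodl_cat prodl_cons prodl_nil mulg1.
move=> t; rewrite mem_cat => /orP[tX|/[!inE]/eqP ->] c ac; apply: (porbit_trans ac); rewrite pE.
  apply: add; apply: IH => //; exact: lconn_step.
have -> : x c = (prodl X * x) ((prodl X)^-1 c) by rewrite permM permKV.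
apply: porbit_trans (porbit_step _ _); apply: add.
by rewrite -porbitV porbit_step.
Qed.

Lemma forest_transitive X Tr : forest X -> transitive_list (X ++ Tr) -> prodl (X ++ Tr) = 1 ->
  transitive_list Tr.
Proof.
move=> FX trX p1 c e; apply: lconn_sub (trX c e) => t; rewrite mem_cat => /orP[tX|/lconn_step//] q.
apply: lconn_porbit_prodl; rewrite (prodl_V p1) porbitV.
by apply: forest_conn => //; exact: lconn_step.
Qed.

Lemma forest_replace pre x R Tr a b : forest (pre ++ x :: R) -> transp Tr ->
  transitive_list (pre ++ x :: R ++ Tr) -> prodl (pre ++ x :: R ++ Tr) = 1 -> a != b ->
  exists Tr', braid (pre ++ x :: R ++ Tr) (pre ++ x ^ tperm a b :: R ++ Tr') /\ transp Tr'.
Proof.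
set X := pre ++ x :: R => FX tTr trX p1 ab.
have XE : X ++ Tr = pre ++ x :: R ++ Tr by rewrite -catA.
rewrite -XE in trX p1.
have trT := forest_transitive FX trX p1.
set rho := prodl R.
(* The twist conjugates [x] by the transposition pulled back along [rho]; starting from
   [tperm (rho a) (rho b)] makes this [tperm a b]. *)
have [|l1 br] := tperm_first tTr (trT (rho a) (rho b)); first by rewrite (inj_eq perm_inj).
have [br2 _ _] := braid_twist pre x R br.
rewrite -[prodl R]/rho -tpermJ conjgK in br2.
eexists; split; first exact: br2.
by move: tTr; rewrite (braid_transp br) /transp /= !rankJ !rank_tperm ?(inj_eq perm_inj).
Qed.

(** * Transversals of cycles and moving one cycle *)

Lemma extend_separated f S : separated f S ->
  exists P, [/\ S \subset P, separated f P & #|P| = #|porbits f|].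
Proof.
have full S0 : separated f S0 -> [forall c, exists a in S0, a \in porbit f c] -> #|S0| = #|porbits f|.
  move=> sS /forallP H; suff -> : porbits f = porbit f @: S0.
    rewrite card_in_imset // => a b aS bS /eqP; rewrite eq_porbit_mem => ba.
    exact/esym/sS.
  apply/setP => C; apply/imsetP/imsetP => -[c cS ->]; last by exists c.
  have /existsP[a /andP[aS ac]] := H c; exists a => //.
  by apply/eqP; rewrite eq_porbit_mem porbit_sym.
move: {2}(#|T| - #|S|) (leqnn (#|T| - #|S|)) => n; elim: n S => [|n IH] S Hn sS;
  have [all_hit|] := boolP [forall c, exists a in S, a \in porbit f c].
1,3: by exists S; split=> //; exact: full.
all: rewrite negb_forall => /existsP[c]; rewrite negb_exists => /forallP N.
all: have cS : c \notin S by apply/negP => cS; have := N c; rewrite cS porbit_id.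
  move: Hn; rewrite leqn0 subn_eq0 => H; case/negP: cS.
  have : S == setT by rewrite eqEcard subsetT cardsT.
  by move=> /eqP ->.
have [||P [SP sP cP]] := IH (c |: S).
- by rewrite cardsU1 cS; move: Hn; lia.
- have F b : b \in S -> b \notin porbit f c by move=> bS; have := N b; rewrite bS.
  move=> a b; rewrite !inE => /orP[/eqP ->|aS] /orP[/eqP ->|bS] //; last exact: sS.
    by move=> H; have := F b bS; rewrite H.
  by rewrite porbit_sym => H; have := F a aS; rewrite H.
exists P; split=> //; exact: subset_trans (subsetUr _ _) SP.
Qed.

(** By [porbit_separated], points of [P1] in one cycle of [f * y] are in one cycle of [y], and two
    distinct such points lie in the support of [y]. *)
Lemma sub_separated f y P1 P : separated f P1 -> supp y \subset P1 -> P \subset P1 ->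
  (forall a b, a \in P -> b \in P -> a \in supp y -> b \in supp y -> a = b) ->
  separated (f * y) P.
Proof.
move=> sP1 /subsetP yP1 /subsetP PP1 H a b aP bP ab.
have {}ab : b \in porbit y a.
  apply: porbit_separated sP1 _ _ _ (PP1 _ aP) (PP1 _ bP) ab => c cP1.
  by apply: not_supp; apply: contra cP1; exact: yP1.
apply/eqP; apply: contraT => nab; move: (nab).
rewrite (H a b) ?eqxx //; first exact: porbit_supp ab.
by rewrite eq_sym in nab; rewrite porbit_sym in ab; exact: porbit_supp ab.
Qed.

Lemma supp_tpermJ x a b c :
  (c \in supp (x ^ tperm a b)) = (tperm a b c \in supp x).
Proof. by rewrite suppJ -{1}[c](tpermK a b) mem_imset //; exact: perm_inj. Qed.

(* Joining the cycles of [f] along the support of [z] or of its conjugate by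
   [tperm a b] leaves room for a common set of representatives. *)
Lemma common_separated f z a b : is_cycle z -> separated f (supp z) ->
  separated f (supp (z ^ tperm a b)) -> a \in supp z -> a != b ->
  exists P, [/\ separated (f * z) P, separated (f * z ^ tperm a b) P
    & #|P| = #|porbits (f * z)|].
Proof.
move=> zc sz sz' aS nab.
have rz : rank (f * z) = (rank f + rank z)%N.
  by apply: rank_separated sz _ => c /not_supp.
have cards P0 c : supp z \subset P0 -> #|P0| = #|porbits f| -> c \in supp z ->
    #|P0 :\: (supp z :\ c)| = #|porbits (f * z)|.
  move=> SP0 cP0 cS; have := cardsID (supp z :\ c) P0.
  rewrite (setIidPr _) ?cP0; last exact: subset_trans (subsetDl _ _) SP0.
  have := rank_cycle zc; rewrite (cardsD1 c) cS.
  have := porbits_rank f; have := porbits_rank (f * z); rewrite rz.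
  by move: #|supp z :\ c| #|P0 :\: (supp z :\ c)| #|porbits f| #|porbits (f * z)| (rank f) (rank z) #|T| => *; lia.
have [good|bad] := boolP ((b \notin supp z) && (b \notin porbit f a)).
  have /andP[bS ba] := good.
  (* Here [b] can join the support without losing separation. The points kept are [a], which
     represents [z], and [b], which represents the conjugate. *)
  have sU : separated f (b |: supp z).
    have F c : c \in supp z -> b \in porbit f c -> b = c.
      move=> cS cb; have [ca|ca] := eqVneq c a; first by move: ba; rewrite -ca cb.
      have cb' : c != b by apply: contraNneq bS => <-.
      apply/esym/sz' => //; rewrite supp_tpermJ ?tpermR //.
      by rewrite tpermD // eq_sym.
    move=> c e; rewrite !in_setU1 => /orP[/eqP ->|cS] /orP[/eqP ->|eS] //; last exact: sz.
      by rewrite porbit_sym; exact: F.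
    by move=> ce; apply/esym/F.
  have [P0 [/subsetP UP0 sP0 cP0]] := extend_separated sU.
  have SP0 : supp z \subset P0 by apply/subsetP => c cS; apply: UP0; rewrite inE cS orbT.
  have bP0 : b \in P0 by apply: UP0; rewrite !inE eqxx.
  exists (P0 :\: (supp z :\ a)); split; last exact: cards.
  - apply: sub_separated sP0 SP0 (subsetDl _ _) _ => c e.
    rewrite !inE => /andP[+ _] /andP[+ _] cS eS; rewrite cS eS !andbT !negbK.
    by move=> /eqP -> /eqP ->.
  - apply: sub_separated sP0 _ (subsetDl _ _) _.
      apply/subsetP => c; rewrite supp_tpermJ; case: tpermP => [->|->|_ _] //.
        by rewrite (negbTE bS).
      exact: (subsetP SP0).
    move=> c e /setDP[_ cN] /setDP[_ eN]; rewrite !supp_tpermJ.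
    have H q : q \notin supp z :\ a -> tperm a b q \in supp z -> q = b.
      rewrite in_setD1; case: tpermP => [->|-> //|/eqP qa _]; first by rewrite (negbTE bS).
      by rewrite qa /= => /negP.
    by move=> /(H c cN) -> /(H e eN).
have [P0 [SP0 sP0 cP0]] := extend_separated sz.
(* In the remaining cases a point [c] other than [a] lies in both supports and is the one kept. *)
have [c cS ca] : exists2 c, c \in supp z & c != a.
  by exists (z a); [rewrite supp_step | move: aS; rewrite inE].
have P0c e q : e \in P0 :\: (supp z :\ c) -> q \in P0 :\: (supp z :\ c) ->
    e \in supp z -> q \in supp z -> e = q.
  rewrite !inE => /andP[+ _] /andP[+ _] eS qS; rewrite eS qS !andbT !negbK.
  by move=> /eqP -> /eqP ->.
exists (P0 :\: (supp z :\ c)); split; last exact: cards.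
  exact: sub_separated sP0 SP0 (subsetDl _ _) P0c.
have [bS|bS] := boolP (b \in supp z).
  have SE e : (e \in supp (z ^ tperm a b)) = (e \in supp z).
    by rewrite supp_tpermJ; case: tpermP => [->|->|] //; rewrite ?aS ?bS.
  apply: sub_separated sP0 _ (subsetDl _ _) _.
    by apply/subsetP => e; rewrite SE; exact: (subsetP SP0).
  by move=> e q; rewrite !SE; exact: P0c.
have ab : b \in porbit f a by move: bad; rewrite bS /= negbK.
have aP0 := subsetP SP0 _ aS.
have bP0 : b \notin P0.
  by apply: contra nab => bP0; apply/eqP; exact: sP0.
(* As [b] is in the cycle of [a], it can replace [a] in the transversal, which then contains the
   support of the conjugate. *)
pose P1 := b |: (P0 :\ a).
have sP1 : separated f P1.
  have F q : q \in P0 :\ a -> q \notin porbit f b.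
    move=> /setD1P[qa qP0]; apply: contra qa => bq; apply/eqP/esym/sP0 => //.
    exact: porbit_trans ab bq.
  move=> e q; rewrite !in_setU1 => /orP[/eqP ->|eP] /orP[/eqP ->|qP] //.
  - by rewrite (negbTE (F q qP)).
  - by rewrite porbit_sym (negbTE (F e eP)).
  - by apply: sP0; [case/setD1P: eP | case/setD1P: qP].
apply: sub_separated sP1 _ _ _.
- apply/subsetP => e; rewrite supp_tpermJ !inE; case: tpermP => [->|->|/eqP ea _].
  + by move=> bS'; rewrite inE bS' in bS.
  + by rewrite eqxx.
  + by move=> eS; rewrite ea (subsetP SP0) ?orbT // inE.
- apply/subsetP => e; rewrite in_setD !in_setU1 !in_setD1 => /andP[eN ->].
  rewrite andbT; apply/orP; right; apply: contraNneq eN => ->.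
  by rewrite aS andbT eq_sym.
- move=> e q eP qP; rewrite !supp_tpermJ.
  have H i : i \in P0 :\: (supp z :\ c) -> tperm a b i \in supp z -> i \in supp z.
    move=> /setDP[iP0 _]; case: tpermP => [->|ib|//]; first by [].
    by move: iP0; rewrite ib (negbTE bP0).
  by move=> /(H e eP) eS /(H q qP); exact: P0c.
Qed.

Lemma card_suppJ x g : #|supp (x ^ g)| = #|supp x|.
Proof. by rewrite suppJ card_imset //; exact: perm_inj. Qed.

Lemma tpermJK x a b g : (x ^ tperm a b) ^ (tperm a b * g) = x ^ g.
Proof. by rewrite -conjgM mulgA tperm2 mul1g. Qed.

(* Two conjugate cycles whose supports meet each cycle of [f] at most once are
   linked by conjugations by transpositions that preserve this property: first
   move the support point by point, then permute the points of the support. *)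
Lemma cycle_chain f (Q : G -> Prop) :
  (forall z a b, is_cycle z -> separated f (supp z) -> separated f (supp (z ^ tperm a b)) ->
     a \in supp z -> a != b -> Q z -> Q (z ^ tperm a b)) ->
  forall z h, is_cycle z -> separated f (supp z) -> separated f (supp (z ^ h)) -> Q z -> Q (z ^ h).
Proof.
move=> Qstep.
(* For a conjugator [h] preserving the support, a step by [tperm a b] with [b = h a] leaves the
   conjugator [tperm a b * h], which fixes [b] and moves fewer points of the support. *)
have stage2 z h : is_cycle z -> separated f (supp z) -> h @: supp z = supp z -> Q z -> Q (z ^ h).
  move: {2}#|[set a in supp z | h a != a]| (leqnn #|[set a in supp z | h a != a]|) => n.
  elim: n z h => [|n IH] z h Hn zc sz hS Qz; have [/eqP M0|/set0Pn[a]] := boolP ([set a in supp z | h a != a] == set0).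
  1,3: suff -> : z ^ h = z by [].
  1,2: have fixS c : c \in supp z -> h c = c
        by move=> cS; apply/eqP; apply: contraT => hc; have := in_set0 c; rewrite -M0 in_set cS hc.
  1,2: apply/permP => c; have [cS|cS] := boolP (c \in supp z);
        [by rewrite -{1}(fixS c cS) permJ fixS ?supp_step
        |by rewrite !not_supp // suppJ hS].
  - by move=> aM; move: Hn; rewrite leqn0 cards_eq0 => /eqP M0; rewrite M0 inE in aM.
  rewrite in_set => /andP[aS ha]; set b := h a in ha.
  have bS : b \in supp z by rewrite -hS imset_f.
  have nab : a != b by rewrite eq_sym.
  have SE : supp (z ^ tperm a b) = supp z.
    by apply/setP => c; rewrite supp_tpermJ; case: tpermP => [->|->|] //; rewrite aS bS.
  rewrite -(tpermJK z a b h); apply: IH.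
  - rewrite SE -ltnS; apply: leq_trans Hn; apply: proper_card; apply/properP; split.
      apply/subsetP => c; rewrite !in_set => /andP[-> /=]; rewrite permM.
      by case: tpermP => [->|->|//]; rewrite ?eqxx // => _; rewrite /b (inj_eq perm_inj) eq_sym.
    exists b; first by rewrite in_set bS /= /b (inj_eq perm_inj).
    by rewrite in_set bS permM tpermR eqxx.
  - exact: is_cycleJ.
  - by rewrite SE.
  - rewrite SE -[RHS]hS; apply/setP => c; rewrite -[c](permKV h) mem_imset; last exact: perm_inj.
    move: (h^-1 c) => {}c; rewrite -{1}[c](tpermK a b) -permM mem_imset; last exact: perm_inj.
    by case: tpermP => [->|->|] //; rewrite aS bS.
  - by apply: Qstep => //; rewrite SE.
move=> z h; move: {2}#|supp (z ^ h) :\: supp z| (leqnn #|supp (z ^ h) :\: supp z|) => n.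
elim: n z h => [|n IH] z h Hn zc sz szh Qz;
  have [Ssub|/subsetPn[v vS' vS]] := boolP (supp (z ^ h) \subset supp z).
1,3: by apply: stage2 => //; apply/eqP; rewrite eqEcard -suppJ Ssub card_suppJ leqnn.
  by move: Hn; rewrite leqn0 cards_eq0 setD_eq0 => /subsetP/(_ v vS'); rewrite (negbTE vS).
(* [u] will give way to [v]. If the old support meets the cycle of [v], then [u] is the meeting
   point, absent from the new support because [v] is there; otherwise any point leaving the support
   will do. *)
have [u [uS uS' sep']] : exists u, [/\ u \in supp z, u \notin supp (z ^ h) &
    forall c, c \in supp z -> c != u -> c \notin porbit f v].
  have [/existsP[u /andP[uS vu]]|] := boolP [exists u in supp z, u \in porbit f v].
    exists u; split=> //; first by apply: contra vS => uS'; rewrite (szh _ _ vS' uS' vu).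
    move=> c cS cu; apply: contra cu => vc; apply/eqP/sz => //.
    by apply: porbit_trans vu; rewrite porbit_sym.
  rewrite negb_exists => /forallP N.
  have [u uS uS'] : exists2 u, u \in supp z & u \notin supp (z ^ h).
    apply/subsetPn; apply/negP => SS; case/negP: vS.
    have /eqP -> // : supp z == supp (z ^ h).
    by rewrite eqEcard SS card_suppJ leqnn.
  exists u; split=> // c cS _; have := N c; by rewrite cS.
have nuv : u != v by apply: contraNneq vS => <-.
have SE c : c \in supp (z ^ tperm u v) -> c = v \/ c \in supp z /\ c != u.
  rewrite supp_tpermJ; case: tpermP => [->|->|/eqP ? _ ?]; last by right.
    by rewrite (negbTE vS).
  by left.
have sz' : separated f (supp (z ^ tperm u v)).
  move=> c e /SE[->|[cS cu]] /SE[->|[eS eu]] //; last exact: sz.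
  - by rewrite (negbTE (sep' e eS eu)).
  - by rewrite porbit_sym (negbTE (sep' c cS cu)).
rewrite -(tpermJK z u v h); apply: IH.
- rewrite tpermJK -ltnS; apply: leq_trans Hn; apply: proper_card; apply/properP; split.
    apply/subsetP => c /setDP[cS' cS]; rewrite in_setD cS' andbT.
    apply: contra cS; rewrite supp_tpermJ; case: tpermP => [cu|->|//].
      by rewrite -cu cS' in uS'.
    by rewrite uS.
  exists v; first by rewrite in_setD vS vS'.
  by rewrite in_setD supp_tpermJ tpermR uS.
- exact: is_cycleJ.
- exact: sz'.
- by rewrite tpermJK.
- exact: Qstep.
Qed.

Lemma classes_all (p : pred G) : (forall x g, p (x ^ g) = p x) ->
  forall X Y, classes_of X = classes_of Y -> all p X = all p Y.
Proof.
move=> pJ X Y /(map_classes pJ) E.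
have H L : all p L = all id (map p L) by rewrite all_map.
by rewrite !H E.
Qed.

Lemma classes_cons x X : classes_of (x :: X) = x ^: [set: G] :: classes_of X.
Proof. by []. Qed.

(** Induction on the number of cycles to change; the first follows [cycle_chain]. Before each step
    the others are moved, by induction, onto the points provided by [common_separated], so that the
    list is a forest before and after the step. *)
Lemma reconfigure xs xs' pre Tr : all (@is_cycle T) xs -> classes_of xs = classes_of xs' ->
  forest (pre ++ xs) -> forest (pre ++ xs') -> transp Tr ->
  transitive_list (pre ++ xs ++ Tr) -> prodl (pre ++ xs ++ Tr) = 1 ->
  sumn (map (@rank T) (pre ++ xs)) < #|T| ->
  exists Tr', braid (pre ++ xs ++ Tr) (pre ++ xs' ++ Tr') /\ transp Tr'.
Proof.
move: {2}(size xs) (leqnn (size xs)) => n.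
elim: n xs xs' pre Tr => [|n IH] [|x R] [|x' R'] pre Tr //.
1,2: by exists Tr; split=> //; exact: braid_refl.
rewrite [size _]/= ltnS => sR.
move=> /= /andP[xc cR] [xx' RR'] FX FX' tTr trX p1 sX.
have catE z L : pre ++ z :: L = (pre ++ [:: z]) ++ L by rewrite -catA.
have [h _ x'E] : exists2 h, h \in [set: G] & x' = x ^ h.
  by apply/imsetP; rewrite -/(class _ _) xx' class_refl.
set f := prodl pre.
have add z L : is_cycle z -> forest (pre ++ z :: L) -> separated f (supp z).
  rewrite catE => zc /forest_cat/forest_rcons[_]; exact: cycle_separated.
have Fpre : forest pre by exact: forest_cat FX.
have ranks z L : classes_of L = classes_of R -> z \in x ^: [set: G] ->
    classes_of (pre ++ z :: L) = classes_of (pre ++ x :: R).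
  by move=> LR /class_eqP zx; rewrite /classes_of !map_cat /= -!/(classes_of _) LR zx.
pose Q z := z \in x ^: [set: G] /\ exists R1 Tr1, [/\ classes_of R1 = classes_of R,
  forest (pre ++ z :: R1), braid (pre ++ x :: R ++ Tr) (pre ++ z :: R1 ++ Tr1) & transp Tr1].
have Qx : Q x.
  split; first exact: class_refl.
  by exists R, Tr; split=> //; exact: braid_refl.
(* Change the remaining cycles before or after changing the first one. *)
have move_tail z L1 L2 Tr1 : z \in x ^: [set: G] -> classes_of L1 = classes_of R ->
    classes_of L2 = classes_of R ->
    forest (pre ++ z :: L1) -> forest (pre ++ z :: L2) -> transp Tr1 ->
    braid (pre ++ x :: R ++ Tr) (pre ++ z :: L1 ++ Tr1) ->
    exists Tr2, braid (pre ++ x :: R ++ Tr) (pre ++ z :: L2 ++ Tr2) /\ transp Tr2.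
  move=> zx L1R L2R F1 F2 tTr1 br.
  have sL : size L1 <= n by rewrite -(size_map (fun x => x ^: [set: G]) L1) -/(classes_of L1) L1R size_map.
  have [||||||||Tr2 [br2 tTr2]] := IH L1 L2 (pre ++ [:: z]) Tr1 sL; rewrite -?catE //.
  - by rewrite (classes_all (@is_cycleJE T) L1R).
  - by rewrite L1R.
  - by move=> a b; rewrite -(braid_lconn br).
  - by rewrite -(braid_prodl br).
  - by rewrite (classes_sumn (ranks _ _ L1R zx)).
  by exists Tr2; split=> //; apply: braid_trans br _; move: br2; rewrite -!catE.
have [x'x [R1 [Tr1 [H1 H2 H3 H4]]]] : Q x'.
  rewrite x'E; apply: (@cycle_chain f) => //; last 2 first.
  - exact: add FX.
  - by rewrite -x'E; apply: add FX'; rewrite x'E; exact: is_cycleJ.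
  move=> z a b zc sz szt aS nab [zx [R1 [Tr1 [H1 H2 H3 H4]]]].
  have [P [sP sP' cP]] := common_separated zc sz szt aS nab.
  have rz : rank (f * z) = (rank f + rank z)%N.
    by apply: rank_separated sz _ => c /not_supp.
  have zc' : is_cycle (z ^ tperm a b) by exact: is_cycleJ.
  have rz' : rank (f * z ^ tperm a b) = (rank f + rank (z ^ tperm a b))%N.
    by apply: rank_separated szt _ => c /not_supp.
  (* [P] has [#|T| - rank f - rank z] points, more than the total rank of the remaining cycles. *)
  have [||R2 [R12 R2P F2]] := @forest_in P R1.
  - by rewrite (classes_all (@is_cycleJE T) H1).
  - rewrite cP (classes_sumn H1); have := porbits_rank (f * z); rewrite rz.
    move: sX; rewrite map_cat sumn_cat /= -Fpre -/f.
    have -> : rank x = rank z by case/imsetP: zx => g _ ->; rewrite rankJ.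
    move: (sumn _) (rank f) (rank z) #|porbits _| #|T| => u v w i j. lia.
  have R2out := prodl_out R2P.
  have forest_z y : separated (f * y) P -> rank (f * y) = (rank f + rank y)%N -> forest (pre ++ y :: R2).
    move=> sy ry; rewrite /forest prodl_cat prodl_cons mulgA (rank_separated sy) // ry.
    by rewrite map_cat sumn_cat /= -Fpre -F2 addnA.
  have F2z := forest_z z sP rz.
  have [Tr2 [br2 tTr2]] := move_tail z R1 R2 Tr1 zx H1 (etrans (esym R12) H1) H2 F2z H4 H3.
  have [||Tr3 [br3 tTr3]] := forest_replace F2z tTr2 _ _ nab.
  - by move=> c e; rewrite -(braid_lconn br2).
  - by rewrite -(braid_prodl br2).
  split; first by have /class_eqP <- := zx; rewrite memJ_class ?inE.
  exists R2, Tr3; split; [by rewrite -R12|exact: forest_z|exact: braid_trans br2 br3|by []].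
exact: move_tail x'x H1 (esym RR') H2 FX' H4 H3.
Qed.

End Reconfigure.

(** * Braid equivalence of tuples with few special elements *)

Section ListTheorem.
Local Open Scope group_scope.
Variable T : finType.
Notation G := {perm T}.
Implicit Types (s t x y z g v f h : G) (l L R X Tr D E : seq G) (a b c e p q r : T) (Z P S A B : {set T}).

Definition conjl h l := [seq x ^ h | x <- l].

Lemma braid_conjl h l L : braid l L -> braid (conjl h l) (conjl h L).
Proof.
elim=> [{}l|{}l x y {}L|{}l {}L _|{}l {}L l3 _ H1 _]; [exact: braid_refl| |exact: braid_sym|exact: braid_trans].
by rewrite /conjl !map_cat /= conjJg; exact: braid_swap.
Qed.

Lemma prodl_conjl h l : prodl (conjl h l) = prodl l ^ h.
Proof.
elim: l => [|x l IH]; first by rewrite prodl_nil conj1g.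
by rewrite /= !prodl_cons IH conjMg.
Qed.

Lemma transp_conjl h l : transp (conjl h l) = transp l.
Proof. by rewrite /transp all_map; apply: eq_all => x /=; rewrite rankJ. Qed.

Lemma classes_conjl h l : classes_of (conjl h l) = classes_of l.
Proof.
by rewrite /classes_of -map_comp; apply: eq_map => x /=; rewrite classGidl ?inE.
Qed.

Lemma forest_conjl h l : forest l -> forest (conjl h l).
Proof.
by rewrite /forest prodl_conjl rankJ => ->; apply: classes_sumn; rewrite classes_conjl.
Qed.

Lemma transitive_conjl h l : transitive_list l -> transitive_list (conjl h l).
Proof.
move=> trl a b; have := trl (h^-1 a) (h^-1 b).
move=> /(lconn_closed (Z := [set c | lconn (conjl h l) a (h c)])).
rewrite !inE !permKV lconn_refl; apply=> // t tl c; rewrite !inE => /lconn_trans; apply.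
by rewrite -permJ; apply: lconn_step; exact: (map_f (fun x => x ^ h)).
Qed.

(** The conjugation [h] aligns the first elements of the two forests, so only the elements behind
    them, which are cycles, have to be reconfigured. *)
Theorem braid_unique X Tr X' Tr' : transp Tr -> transp Tr' ->
  transitive_list (X ++ Tr) -> transitive_list (X' ++ Tr') ->
  prodl (X ++ Tr) = 1 -> prodl (X' ++ Tr') = 1 ->
  all (@is_cycle T) (behead X) -> classes_of X = classes_of X' -> size Tr = size Tr' ->
  sumn (map (@rank T) X) < #|T| ->
  exists h, braid (X ++ Tr) (conjl h (X' ++ Tr')).
Proof.
move=> tT tT' trX trX' p1 p1' cX XX' sT sX.
have [X1 [Tr1 [br cl tT1 trT1 F1]]] := make_forest tT trX p1 cX sX.
rewrite (classes_cycles XX') in cX; rewrite (classes_sumn XX') in sX.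
have [X1' [Tr1' [br' cl' tT1' trT1' F1']]] := make_forest tT' trX' p1' cX sX.
have XX1 : classes_of X1 = classes_of X1' by rewrite -cl -cl'.
have sX1 : size X1 = size X by rewrite -(size_map (fun x => x ^: [set: G])) -/(classes_of _) -cl size_map.
have sX1' : size X1' = size X by rewrite -(size_map (fun x => x ^: [set: G])) -/(classes_of _) -cl' -XX' size_map.
have sX' : size X' = size X by rewrite -(size_map (fun x => x ^: [set: G])) -/(classes_of _) -XX' size_map.
have sT1 : size Tr1 = size Tr1'.
  have := braid_size br; have := braid_size br'.
  rewrite !size_cat sX1 sX1' sX' -sT => /eqP; rewrite eqn_add2l => /eqP <- /eqP.
  by rewrite eqn_add2l => /eqP.
suff [h H] : exists h, braid (X1 ++ Tr1) (conjl h (X1' ++ Tr1')).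
  exists h; apply: braid_trans br _; apply: braid_trans H _.
  exact/braid_conjl/braid_sym.
rewrite (braid_prodl br) in p1; rewrite (braid_prodl br') in p1'.
rewrite (classes_cycles cl') in cX; rewrite (classes_sumn cl') in sX.
clear X Tr X' Tr' br br' cl cl' tT tT' trX trX' sT XX' sX1 sX1' sX'.
case: X1 XX1 F1 p1 => [|y xs]; case: X1' F1' p1' cX sX => [|y' xs'] //=.
  move=> _ p1' _ _ _ _ p1; exists 1.
  have -> : conjl 1 Tr1' = Tr1'.
    by rewrite -[RHS]map_id; apply: eq_map => x; rewrite conjg1.
  by apply: transp_braid => //; rewrite p1 p1'.
move=> F1' p1' cX sX [yy' xxs] F1 p1.
have [h _ yE] : exists2 h, h \in [set: G] & y = y' ^ h.
  by apply/imsetP; rewrite -/(class _ _) -yy' class_refl.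
exists h; set X' := y' :: xs'; pose xs2 := conjl h xs'.
have X2E : conjl h X' = y :: xs2 by rewrite yE.
have F2 : forest ([:: y] ++ xs2) by rewrite /= -X2E; exact: forest_conjl.
have [||||Tr2 [br2 tT2]] := @reconfigure T xs xs2 [:: y] Tr1 _ _ F1 F2 tT1 _ p1.
- by rewrite (classes_all (@is_cycleJE T) xxs).
- by rewrite classes_conjl.
- exact/transitive_catr/transitive_catr.
- by rewrite /= (classes_sumn xxs) yE rankJ.
have -> : y' ^ h :: conjl h (xs' ++ Tr1') = [:: y] ++ xs2 ++ conjl h Tr1'.
  by rewrite -yE /conjl map_cat.
apply: (braid_trans br2); rewrite !catA; apply: braid_catl.
have trT2 : transitive_list Tr2.
  apply: (forest_transitive F2); last by rewrite -catA -(braid_prodl br2).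
  by move=> a b; rewrite -catA -(braid_lconn br2); apply/transitive_catr/transitive_catr.
apply: transp_braid => //; first by rewrite transp_conjl.
- exact: transitive_conjl.
- have q1 : prodl (([:: y] ++ xs2) ++ Tr2) = 1 by rewrite -catA -(braid_prodl br2).
  have q2 : prodl (([:: y] ++ xs2) ++ conjl h Tr1') = 1.
    by rewrite [[:: y] ++ _]/= -X2E -map_cat -/(conjl h _) prodl_conjl p1' conj1g.
  by rewrite (prodl_V q1) (prodl_V q2).
- have E : size xs' = size xs.
    by rewrite -[RHS](size_map (fun x => x ^: [set: G])) -/(classes_of xs) xxs size_map.
  have := braid_size br2; rewrite !size_cat !size_map E sT1 => /eqP.
  by rewrite !eqn_add2l => /eqP ->.
Qed.

(** A forest is completed by the base of [transp_normal_form] for its inverse product, of length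
    [2 * #|T| - 2] minus the total rank. The genus [k] counts the surplus pairs; for positive [k] a
    transposition must exist, whence the condition on [k]. *)
Theorem braid_exists X0 (N k : nat) : all (@is_cycle T) (behead X0) ->
  sumn (map (@rank T) X0) < #|T| -> k = 0 \/ 1 < #|T| ->
  (N + sumn (map (@rank T) X0) + 2 = #|T|.*2 + k.*2)%N ->
  exists X Tr, [/\ classes_of X = classes_of X0, transp Tr, size Tr = N,
    prodl (X ++ Tr) = 1 & transitive_list (X ++ Tr)].
Proof.
move=> cX sX kT NE.
have [X [clX FX]] : exists X, classes_of X = classes_of X0 /\ forest X.
  case: X0 cX sX {NE} => [|y xs] /= cX sX.
    by exists [::]; rewrite /forest prodl_nil rank1.
  (* The cycles in [xs] are placed on a transversal of the cycles of [y]. *)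
  have [|P [_ sP cP]] := @extend_separated _ y set0; first by move=> a b; rewrite inE.
  have [|xs' [H1 H2 H3]] := @forest_in _ P xs cX.
    by rewrite cP; move: sX (porbits_rank y); move: (sumn _) (rank y) #|porbits _| #|T| => *; lia.
  exists (y :: xs'); split; first by rewrite !classes_cons H1.
  rewrite /forest prodl_cons /= -H3; apply: rank_separated sP _; exact: prodl_out.
have /card_gt0P[r _] : 0 < #|T| by exact: leq_ltn_trans sX.
have [base [H1 H2 H3 H4 _]] := transp_normal_form (prodl X)^-1 r.
have [E tE sE] : exists2 E : seq G, transp E & size E = k.
  case: kT => [->|/card_gt1P[a [b [_ _ ab]]]]; first by exists [::].
  exists (nseq k (tperm a b)); last by rewrite size_nseq.
  by rewrite /transp all_nseq rank_tperm ?orbT.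
exists X, (dbl E ++ base); split=> //.
- by rewrite transp_cat dbl_transp tE.
- rewrite size_cat size_dbl H4 sE /rank porbitsV -/(rank _) FX (classes_sumn clX).
  have := porbits_rank (prodl X); rewrite FX (classes_sumn clX).
  by move: sX NE; move: (sumn _) #|porbits _| #|T| => u v w; lia.
- by rewrite !prodl_cat prodl_dbl // H2 mul1g mulgV.
- by rewrite catA; exact: transitive_catr.
Qed.

End ListTheorem.

(** * Cycle types *)

Section CycleType.
Local Open Scope group_scope.
Variable T : finType.
Notation G := {perm T}.
Implicit Types (s t x y z g v f h : G) (a b c e p q r : T) (Z P S A B : {set T}).

Lemma expg_porbit s p i j :
  ((s ^+ i) p == (s ^+ j) p) = (i == j %[mod #|porbit s p|]).
Proof.
set n := #|porbit s p|.
have n0 : 0 < n by rewrite lt0n card_porbit_neq0.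
have sn m : (s ^+ (m * n)) p = p.
  elim: m => [|m IH]; first by rewrite mul0n expg0 perm1.
  have sn1 : (s ^+ n) p = p by rewrite permX; exact: iter_porbit.
  by rewrite mulSn expgD permM sn1 IH.
have smod m : (s ^+ m) p = (s ^+ (m %% n)) p.
  by rewrite {1}(divn_eq m n) expgD permM sn.
have nth_s m : m < n -> (s ^+ m) p = nth p (traject s p n) m.
  by move=> mn; rewrite nth_traject // permX.
rewrite smod [X in _ == X]smod !nth_s ?ltn_mod // nth_uniq ?size_traject ?ltn_mod //.
exact: uniq_traject_porbit.
Qed.

Definition cycle_lengths s := [seq #|C| | C : {set T} in porbits s].

(** Match the cycles of [x] with cycles of [y] of the same length by [phi], choose base points, and
    send each iterate of one base point to the same iterate of the other. *)
Lemma perm_cycle_lengths_conj x y :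
  perm_eq (cycle_lengths x) (cycle_lengths y) -> exists h, y = x ^ h.
Proof.
move=> /(perm_iotaP 0)[Is pIs]; rewrite /cycle_lengths /image_mem size_map in pIs *; move=> E.
set s := enum (porbits x) in E; set s' := enum (porbits y) in E pIs.
pose u := map (nth set0 s') Is.
have us' : perm_eq u s'.
  by rewrite /u -{2}(mkseq_nth set0 s') /mkseq perm_map.
have uniq_u : uniq u by rewrite (perm_uniq us') enum_uniq.
have Eu : [seq #|C| | C : {set T} <- s] = [seq #|C| | C : {set T} <- u].
  rewrite E /u -map_comp; apply/eq_in_map => i iIs /=.
  by rewrite (nth_map set0) //; move: iIs; rewrite (perm_mem pIs) mem_iota.
have su : size s = size u by have := congr1 size Eu; rewrite !size_map.
pose phi C := nth set0 u (index C s).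
have ins C : C \in porbits x -> index C s < size u by rewrite -su index_mem mem_enum.
have phiP C : C \in porbits x -> phi C \in porbits y.
  move=> Cx; have : phi C \in u by rewrite mem_nth // ins.
  by rewrite (perm_mem us') mem_enum.
have phi_card C : C \in porbits x -> #|phi C| = #|C|.
  move=> Cx; have Cs : C \in s by rewrite mem_enum.
  have := congr1 (fun l => nth 0%N l (index C s)) Eu.
  by rewrite !(nth_map set0) ?ins ?index_mem // nth_index.
have phi_inj C D : C \in porbits x -> D \in porbits x -> phi C = phi D -> C = D.
  move=> Cx Dx /eqP; rewrite nth_uniq ?ins // => /eqP.
  by apply: index_inj; rewrite ?mem_enum.
pose px a := odflt a [pick c in porbit x a].
pose qx a := odflt a [pick c in phi (porbit x a)].
have pxP a : porbit x (px a) = porbit x a.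
  apply/eqP; rewrite eq_porbit_mem /px; case: pickP => [//|/(_ a)].
  by rewrite porbit_id.
have pxE a b : porbit x a = porbit x b -> px a = px b.
  by rewrite /px => ->; case: pickP => [//|/(_ b)]; rewrite porbit_id.
have xin a : porbit x a \in porbits x by exact: imset_f.
have nonempty a : exists c, c \in phi (porbit x a).
  have /imsetP[c _ ->] := phiP _ (xin a).
  by exists c; rewrite porbit_id.
have qxP a : porbit y (qx a) = phi (porbit x a).
  rewrite /qx; case: pickP => [c|N]; last by have [c] := nonempty a; rewrite N.
  have /imsetP[e _ ->] := phiP _ (xin a).
  by rewrite -eq_porbit_mem => /eqP.
have qxE a b : porbit x a = porbit x b -> qx a = qx b.
  rewrite /qx => ->; case: pickP => [//|N]; by have [c] := nonempty b; rewrite N.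
have cardE a : #|porbit y (qx a)| = #|porbit x (px a)|.
  by rewrite qxP phi_card // pxP.
have [h0 h0P] : exists h0 : T -> T, forall a, exists i, a = (x ^+ i) (px a) /\ h0 a = (y ^+ i) (qx a).
  apply: (@fin_all_exists _ _ (fun a b => exists i, a = (x ^+ i) (px a) /\ b = (y ^+ i) (qx a))).
  move=> a; have /porbitP[i ai] : a \in porbit x (px a) by rewrite pxP porbit_id.
  by exists ((y ^+ i) (qx a)), i.
have h0_porbit a : porbit y (h0 a) = phi (porbit x a).
  by have [i [_ ->]] := h0P a; rewrite porbit_perm qxP.
have h0_inj : injective h0.
  move=> a b hab.
  have /phi_inj ab : phi (porbit x a) = phi (porbit x b) by rewrite -!h0_porbit hab.
  have {}ab := ab (xin a) (xin b).
  have [i [ai ha]] := h0P a; have [j [bj hb]] := h0P b.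
  have := hab; rewrite ha hb (qxE _ _ ab) => /eqP; rewrite expg_porbit cardE -expg_porbit => /eqP.
  by rewrite -(pxE _ _ ab) -ai (pxE _ _ ab) -bj.
exists (perm h0_inj); apply/permP => b.
rewrite -[b](permKV (perm h0_inj)) permJ; move: ((perm h0_inj)^-1 b) => a.
rewrite !permE.
have xa : porbit x (x a) = porbit x a by apply/eqP; rewrite eq_porbit_mem porbit_step.
have [i [ai ->]] := h0P a; have [j [aj ->]] := h0P (x a).
rewrite (qxE _ _ xa) -permM -expgSr; apply/eqP.
rewrite expg_porbit cardE -expg_porbit expgSr permM -ai.
by rewrite {1}aj (pxE _ _ xa).
Qed.

Lemma cycle_lengthsJ x g : perm_eq (cycle_lengths (x ^ g)) (cycle_lengths x).
Proof.
have inj : injective (fun C : {set T} => g @: C) by exact/imset_inj/perm_inj.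
have -> : cycle_lengths x = [seq #|C| | C : {set T} <- [seq g @: (C : {set T}) | C <- enum (porbits x)]].
  rewrite -map_comp; apply: eq_map => C /=; rewrite card_imset //; exact: perm_inj.
apply: perm_map; apply: uniq_perm; rewrite ?enum_uniq ?map_inj_uniq ?enum_uniq // => C.
rewrite mem_enum porbits_conj; apply/imsetP/mapP => -[D DX ->]; exists D; by rewrite ?mem_enum // -mem_enum.
Qed.

Lemma cycle_on S : exists c : G, (forall a, a \notin S -> c a = a) /\
  (forall a b, a \in S -> b \in S -> b \in porbit c a).
Proof.
move: {2}#|S| (erefl #|S|) => n; elim: n S => [|n IH] S.
  move/eqP; rewrite cards_eq0 => /eqP ->; exists 1; split=> [a _|a b]; by rewrite ?perm1 ?inE.
move=> Sn; have /card_gt0P[a aS] : 0 < #|S| by rewrite Sn.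
have [|c [c1 c2]] := IH (S :\ a); first by move: Sn; rewrite (cardsD1 a) aS => -[].
have [S0|/set0Pn[b bS]] := boolP (S :\ a == set0).
  exists 1; split=> [e _|e1 e2]; first by rewrite perm1.
  have H e : e \in S -> e = a.
    by move=> eS; apply/eqP; apply: contraT => ea; have := in_set0 e; rewrite -(eqP S0) !inE ea eS.
  by move=> /H -> /H ->; rewrite porbit_id.
have ca : c a = a by apply: c1; rewrite !inE eqxx.
have ab : a \notin porbit c b.
  rewrite porbit_sym; apply/negP => /(porbit_fix ca) ba.
  by move: bS; rewrite ba !inE eqxx.
exists (c * tperm a b); split.
  move=> e eS; rewrite permM c1; last by apply: contra eS => /setD1P[].
  rewrite tpermD //; apply: contraNneq eS => <- //.
  by case/setD1P: bS.
have H e : e \in S -> e \in porbit (c * tperm a b) b.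
  move=> eS; have [->|ea] := eqVneq e a; first exact: porbit_join.
  by apply: porbit_join_sub ab _ _ _; apply: c2; rewrite // !inE ea.
move=> e1 e2 /H H1 /H; apply: porbit_trans; by rewrite porbit_sym.
Qed.

(** Each part receives a block of its own. Only cycles through [P] are counted, so that in the
    induction the points outside [P], being fixed, contribute no parts 1. *)
Lemma exists_cycle_lengths (l : seq nat) P : 0%N \notin l -> sumn l = #|P| ->
  exists x, (forall a, a \notin P -> x a = a) /\
    perm_eq [seq #|C| | C : {set T} in [set porbit x a | a in P]] l.
Proof.
elim: l P => [|n l IH] P.
  move=> _ /esym/eqP; rewrite cards_eq0 => /eqP ->; exists 1; split=> [a _|]; first by rewrite perm1.
  by rewrite imset0 /image_mem enum_set0.
rewrite inE negb_or eq_sym -lt0n => /andP[n0 l0] /= sP.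
have [S SP cS] : exists2 S : {set T}, S \subset P & n = #|S|.
  exists [set a in take n (enum P)].
    by apply/subsetP => a; rewrite inE => /mem_take; rewrite mem_enum.
  rewrite [RHS]cardsE (card_uniqP _) ?take_uniq ?enum_uniq // size_take -cardE.
  by case: ltnP => //; move: sP; lia.
have [|x [x1 x2]] := IH (P :\: S) l0.
  by have := cardsID S P; rewrite (setIidPr SP) -sP -cS => /addnI.
have [c [c1 c2]] := cycle_on S.
have xS a : a \in S -> x a = a by move=> aS; apply: x1; rewrite inE aS.
have porS a : a \in S -> porbit (c * x) a = S.
  move=> aS; have cs e : e \in S -> (c * x) e = c e.
    move=> eS; rewrite permM xS //; apply: contraT => ceS.
    by have := c1 _ ceS => /perm_inj ce; rewrite ce eS in ceS.
  have cS' e : e \in S -> c e \in S.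
    move=> eS; apply: contraT => ceS.
    by have := c1 _ ceS => /perm_inj ce; rewrite ce eS in ceS.
  apply/eqP; rewrite eqEsubset; apply/andP; split; apply/subsetP => b.
    by apply: porbit_sub_closed aS => e eS; rewrite cs // cS'.
  move=> /(c2 _ _ aS) ab; have : b \in porbit (c * x) a :&: S.
    apply: porbit_sub_closed ab => [e|]; last by rewrite inE porbit_id.
    move=> /setIP[ae eS]; rewrite in_setI cS' // -cs // andbT.
    exact: porbit_trans ae (porbit_step _ _).
  by case/setIP.
have porN a : a \in P :\: S -> porbit (c * x) a = porbit x a.
  have xN e : e \in P :\: S -> x e \in P :\: S.
    move=> eP; apply: contraT => xeP.
    by have := x1 _ xeP => /perm_inj xe; rewrite xe eP in xeP.
  have cxN e : e \in P :\: S -> (c * x) e = x e.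
    by move=> /setDP[_ eS]; rewrite permM c1.
  move=> aP; apply/eqP; rewrite eqEsubset; apply/andP; split; apply/subsetP => b ab.
    have : b \in porbit x a :&: (P :\: S).
      apply: porbit_sub_closed ab => [e|]; last by rewrite in_setI porbit_id.
      move=> /setIP[ae eP]; rewrite in_setI cxN // xN // andbT.
      exact: porbit_trans ae (porbit_step _ _).
    by case/setIP.
  have : b \in porbit (c * x) a :&: (P :\: S).
    apply: porbit_sub_closed ab => [e|]; last by rewrite in_setI porbit_id.
    move=> /setIP[ae eP]; rewrite in_setI xN // -cxN // andbT.
    exact: porbit_trans ae (porbit_step _ _).
  by case/setIP.
exists (c * x); split.
  move=> a aP; rewrite permM c1; first by apply: x1; apply: contra aP => /setDP[].
  by apply: contra aP; exact: (subsetP SP).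
have imE : [set porbit (c * x) a | a in P] = S |: [set porbit x a | a in P :\: S].
  apply/setP => C; rewrite in_setU1; apply/imsetP/orP.
    move=> [a aP ->]; have [aS|aS] := boolP (a \in S); first by left; rewrite porS.
    by right; rewrite porN ?imset_f // inE aS.
  move=> [/eqP ->|/imsetP[a aP ->]].
    have /card_gt0P[a aS] : 0 < #|S| by rewrite -cS.
    by exists a; [exact: (subsetP SP)|rewrite porS].
  by exists a; [case/setDP: aP|rewrite porN].
have SN : S \notin [set porbit x a | a in P :\: S].
  apply/imsetP => -[a /setDP[_ aS] E]; by rewrite E porbit_id in aS.
apply: (@perm_trans _ (n :: [seq #|C| | C : {set T} in [set porbit x a | a in P :\: S]])); last by rewrite perm_cons.
have -> : n :: [seq #|C| | C : {set T} in [set porbit x a | a in P :\: S]] =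
    map (fun C : {set T} => #|C|) (S :: enum [set porbit x a | a in P :\: S]) by rewrite /= -cS.
apply: perm_map; apply: uniq_perm; rewrite ?enum_uniq //=; first by rewrite mem_enum SN enum_uniq.
by move=> C; rewrite mem_enum imE in_setU1 inE mem_enum.
Qed.

End CycleType.

Section Types.
Local Open Scope group_scope.
Variable d : nat.
Implicit Types (x y g : 'S_d) (p : seq nat).

Lemma geq_total : total geq. Proof. by move=> a b; exact: leq_total. Qed.
Lemma geq_trans : transitive geq. Proof. by move=> a b c ba cb; exact: leq_trans cb ba. Qed.
Lemma geq_anti : antisymmetric geq. Proof. by move=> a b /anti_leq. Qed.

Lemma cycle_type_conj x y : cycle_type x = cycle_type y -> exists g, y = x ^ g.
Proof.
move=> /(perm_sortP geq_total geq_trans geq_anti); exact: perm_cycle_lengths_conj.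
Qed.

Lemma cycle_typeJ x g : cycle_type (x ^ g) = cycle_type x.
Proof.
apply/(perm_sortP geq_total geq_trans geq_anti); exact: cycle_lengthsJ.
Qed.

Lemma exists_cycle_type p : is_partition_of d p -> exists x, cycle_type x = p.
Proof.
move=> /and3P[sp p0 /eqP pd].
have [|x [_ H]] := @exists_cycle_lengths 'I_d p setT p0; first by rewrite cardsT card_ord.
exists x; apply: (sorted_eq geq_trans geq_anti) => //; first exact/sort_sorted/geq_total.
rewrite perm_sort; apply: perm_trans H.
suff -> : porbits x = [set porbit x a | a in [set: 'I_d]] by exact: perm_refl.
by apply/setP => C; apply/imsetP/imsetP => -[a _ ->]; exists a.
Qed.

Lemma rank_cycle_type x : rank x = (d - size (cycle_type x))%N.
Proof. by rewrite size_sort size_map -cardE /rank card_ord. Qed.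

Lemma pure_is_cycle x : pure (cycle_type x) -> is_cycle x.
Proof.
rewrite /pure /cycle_type (seq.permP (permEl (perm_sort _ _))) count_map.
set A := porbits x; rewrite -size_filter => /eqP H.
have [C FE] : exists C, filter (preim (fun C : {set 'I_d} => #|C|) (predC1 1%N)) (enum A) = [:: C].
  by case: (filter _ _) H => [|C [|D l]] // _; exists C.
have inF D : (D \in A) && (#|D| != 1%N) = (D == C).
  have := congr1 (fun l : seq {set 'I_d} => D \in l) FE.
  by rewrite mem_filter mem_enum mem_seq1 andbC.
have : (C \in A) && (#|C| != 1%N) by rewrite inF eqxx.
move=> /andP[/imsetP[p _ CE] C1].
have card1 q : x q = q -> #|porbit x q| = 1%N.
  move=> xq; apply/eqP/cards1P; exists q; apply/setP => e; rewrite inE.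
  by apply/idP/eqP => [/(porbit_fix xq)|->]; rewrite ?porbit_id.
apply/existsP; exists p; apply/andP; split.
  by apply: contraNneq C1 => /card1; rewrite CE => ->.
apply/subsetP => q; rewrite inE => xq.
have : porbit x q == C.
  rewrite -inF imset_f //=; apply: contra xq => /cards1P[e E].
  have := porbit_id x q; have := porbit_step x q; rewrite E !inE => /eqP -> /eqP ->.
  by [].
by rewrite CE eq_porbit_mem.
Qed.

End Types.

(** * From lists to the braid group *)

Section BraidTypes.
Local Open Scope group_scope.
Variables (T : finType) (A : eqType) (f : {perm T} -> A).
Hypothesis fJ : forall x g, f (x ^ g) = f x.

Lemma braid_perm_map l r : braid l r -> perm_eq (map f l) (map f r).
Proof.
elim=> [{}l|{}l x y {}r|{}l {}r _|l1 l2 l3 _ H1 _ H2] //.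
- rewrite !map_cat /= fJ perm_cat2l.
  exact: (permEl (perm_catCA [:: f x] [:: f y] _)).
- by rewrite perm_sym.
- exact: perm_trans H1 H2.
Qed.

(** An element of the wanted type goes to the front unchanged, and those it passes are only
    conjugated. This allows the unordered types to be put in a chosen order. *)
Lemma braid_sort l e : perm_eq (map f l) e -> exists2 l', braid l l' & map f l' = e.
Proof.
elim: e l => [|p e IH] l pe.
  by exists l; [exact: braid_refl | apply/nilP; rewrite /nilp (perm_size pe)].
have : p \in map f l by rewrite (perm_mem pe) mem_head.
move=> /mapP[x xl fx]; case/splitPr: xl pe => l1 l2 pe.
have [l1' [br El]] := braid_left x l1 l2.
have E1 : map f l1' = map f l1 by rewrite El -map_comp; apply: eq_map => y /=; rewrite fJ.
have [|l' br' <-] := IH (l1' ++ l2).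
  rewrite -(perm_cons p); apply: perm_trans pe.
  by rewrite !map_cat E1 /= -fx -cat1s perm_catCA.
by exists (x :: l'); [apply: (braid_trans br); exact: braid_cons | rewrite /= fx].
Qed.

End BraidTypes.

(** * Tuples read as lists *)

Section Bridge.
Local Open Scope group_scope.
Variables d s : nat.
Notation tup := {ffun 'I_s -> 'S_d}.
Implicit Types (t u : tup) (l r : seq 'S_d) (eta : s.-tuple (seq nat)).

Definition tlist t : seq 'S_d := [seq t i | i <- enum 'I_s].

Lemma size_tlist t : size (tlist t) = s.
Proof. by rewrite size_map size_enum_ord. Qed.

Lemma nth_tlist t (i : 'I_s) : nth 1 (tlist t) i = t i.
Proof. by rewrite (nth_map i) ?size_enum_ord // nth_ord_enum. Qed.

Lemma tlist_inj : injective tlist.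
Proof. by move=> t u E; apply/ffunP => i; rewrite -!nth_tlist E. Qed.

Lemma tlistP t l : size l = s -> (forall i : 'I_s, nth 1 l i = t i) -> tlist t = l.
Proof.
move=> sl H; apply: (@eq_from_nth _ 1); first by rewrite size_tlist.
by move=> i; rewrite size_tlist => si; rewrite (nth_tlist t (Ordinal si)) -H.
Qed.

Lemma tlist_surj l : size l = s -> exists t, tlist t = l.
Proof.
by move=> sl; exists [ffun i : 'I_s => nth 1 l i]; apply: tlistP => // i; rewrite ffunE.
Qed.

Lemma tlist_conj t h : tlist (conj_tuple t h) = conjl h (tlist t).
Proof. by rewrite /conjl -map_comp; apply: eq_map => i; rewrite /= ffunE. Qed.

Lemma tlist_swap t (i j : 'I_s) l x y r : j = i.+1 :> nat -> size l = i ->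
  tlist t = l ++ x :: y :: r -> tlist (braid_move i j t) = l ++ y :: x ^ y :: r.
Proof.
move=> ji li E.
have nE k : nth 1 (tlist t) k = nth 1 (l ++ x :: y :: r) k by rewrite E.
have ti : t i = x by rewrite -nth_tlist E nth_cat li ltnn subnn.
have tj : t j = y by rewrite -nth_tlist E nth_cat li ji ltnNge leqnSn /= subSn // subnn.
apply: tlistP; first by rewrite -(size_tlist t) E !size_cat.
move=> k; rewrite ffunE -(nth_tlist t k) E !nth_cat li.
have [->|ki] := eqVneq k i; first by rewrite ltnn subnn /= tj.
have [->|kj] := eqVneq k j; first by rewrite ji ltnNge leqnSn /= subSn // subnn /= ti tj.
have [//|ik] := ltnP k i.
have : i.+1 < k.
  move: ki kj; rewrite -!val_eqE /= ji; move: ik; rewrite leq_eqVlt eq_sym => /orP[->//|].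
  by rewrite leq_eqVlt eq_sym => /orP[->//|].
by move=> lt; case E': (k - i)%N => [|[|m]] //; move: E' lt; lia.
Qed.

Lemma tlist_split t (i j : 'I_s) : j = i.+1 :> nat ->
  exists l r, size l = i /\ tlist t = l ++ t i :: t j :: r.
Proof.
move=> ji; exists (take i (tlist t)), (drop j.+1 (tlist t)).
have si : i < size (tlist t) by rewrite size_tlist.
have sj : j < size (tlist t) by rewrite size_tlist.
rewrite size_take si; split=> //.
by rewrite -!nth_tlist -(drop_nth 1 sj) ji -(drop_nth 1 si) cat_take_drop.
Qed.

(** The group is finite, so every element is a product of generators and no case for inverses
    arises. *)
Lemma braid_group_ind (P : {perm tup} -> Prop) : P 1 ->
  (forall g h, P g -> P h -> P (g * h)) ->
  (forall i j : 'I_s, j = i.+1 :> nat -> P (braid_perm d i j)) ->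
  forall g, g \in braid_group d s -> P g.
Proof.
move=> P1 PM Pgen g /gen_prodgP[n [c cgen ->]].
apply: big_ind => // i _; have /imsetP[[a b]] := cgen i.
by rewrite inE /= => /eqP ab ->; exact: Pgen.
Qed.

Lemma braid_permE (i j : 'I_s) t : braid_perm d i j t = braid_move i j t.
Proof. by rewrite permE. Qed.

Lemma braid_group_list g t : g \in braid_group d s -> braid (tlist t) (tlist (g t)).
Proof.
move=> gB; elim/braid_group_ind: gB t => [t|g1 g2 H1 H2 t|i j ji t].
- by rewrite perm1; exact: braid_refl.
- by rewrite permM; exact: braid_trans (H1 t) (H2 _).
- have [l [r [sl E]]] := tlist_split t ji.
  by rewrite braid_permE (tlist_swap ji sl E) E; exact: braid_swap.
Qed.

Lemma braid_group_conj g t h : g \in braid_group d s -> g (conj_tuple t h) = conj_tuple (g t) h.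
Proof.
move=> gB; elim/braid_group_ind: gB t => [t|g1 g2 H1 H2 t|i j ji t].
- by rewrite !perm1.
- by rewrite !permM H1 H2.
- rewrite !braid_permE; apply/ffunP => k; rewrite !ffunE.
  by case: (k == i) => //; case: (k == j) => //; rewrite [RHS]conjJg.
Qed.

Lemma list_braid_group l r : braid l r -> forall t, tlist t = l ->
  exists2 g, g \in braid_group d s & tlist (g t) = r.
Proof.
elim=> [{}l|{}l x y {}r|{}l {}r br IH|l1 l2 l3 _ IH1 _ IH2] t E.
- by exists 1; rewrite ?group1 ?perm1.
- have sl : size l < s by rewrite -(size_tlist t) E size_cat /=; lia.
  have sl1 : (size l).+1 < s by rewrite -(size_tlist t) E size_cat /=; lia.
  exists (braid_perm d (Ordinal sl) (Ordinal sl1)).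
    by apply/mem_gen/imsetP; exists (Ordinal sl, Ordinal sl1); rewrite // inE /=.
  by rewrite braid_permE; exact: tlist_swap E.
- have [|u uE] := @tlist_surj l; first by rewrite (braid_size br) -E size_tlist.
  have [g gB gE] := IH u uE; exists g^-1; first by rewrite groupV.
  by rewrite -(tlist_inj (etrans gE (esym E))) permK.
- have [g gB gE] := IH1 t E; have [g' gB' gE'] := IH2 _ gE.
  by exists (g * g'); rewrite ?groupM // permM.
Qed.

Lemma transitive_listP t : 0 < d ->
  [transitive <<[set t i | i : 'I_s]>>, on [set: 'I_d] | 'P] <-> transitive_list (tlist t).
Proof.
move=> d0; set S := [set t i | i : 'I_s]; split.
  move=> tr a b.
  have : b \in orbit 'P <<S>> a by rewrite (atransP tr) inE.
  move=> /orbitP[g gS <-]; pose Z := [set c | lconn (tlist t) a c].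
  have : <<S>> \subset 'N(Z | 'P).
    rewrite gen_subG; apply/subsetP => _ /imsetP[i _ ->].
    rewrite 3!inE /=. apply/subsetP => c; rewrite !inE => ac.
    by apply: lconn_trans ac (lconn_step _ _); rewrite map_f ?mem_enum.
  by move=> /subsetP/(_ g gS)/astabs_act E; have := E a; rewrite !inE lconn_refl.
move=> trl; apply/imsetP; exists (Ordinal d0); rewrite ?inE //.
apply/esym/setP => b; rewrite inE.
apply: lconn_closed (orbit_refl _ _ _) (trl (Ordinal d0) b) => _ /mapP[i _ ->] c.
move=> /orbitP[g gS <-]; apply/orbitP; exists (g * t i).
  by rewrite groupM // mem_gen // imset_f.
by rewrite actM.
Qed.

Lemma hurwitz_tupleP eta t : 0 < d -> hurwitz_tuple eta t <->
  [/\ perm_eq (map (@cycle_type d) (tlist t)) eta, prodl (tlist t) = 1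
    & transitive_list (tlist t)].
Proof.
move=> d0; rewrite /hurwitz_tuple.
have -> : \prod_(i < s) t i = prodl (tlist t).
  by rewrite /prodl /tlist big_map enumT [index_enum _]unlock.
have -> : map (@cycle_type d) (tlist t) = [seq cycle_type (t i) | i <- enum 'I_s].
  by rewrite /tlist -map_comp.
split=> [/and3P[H1 /eqP H2 /(transitive_listP t d0) H3]|[H1 H2 H3]] //.
by apply/and3P; split; [|exact/eqP|exact/transitive_listP].
Qed.

Lemma braid_group_hurwitz eta g t : 0 < d -> g \in braid_group d s ->
  hurwitz_tuple eta t -> hurwitz_tuple eta (g t).
Proof.
move=> d0 /(braid_group_list t) br /(hurwitz_tupleP _ _ d0)[H1 H2 H3].
apply/hurwitz_tupleP => //; split.
- by apply: perm_trans H1; rewrite perm_sym; apply: braid_perm_map br; exact: cycle_typeJ.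
- by rewrite -(braid_prodl br).
- by move=> a b; rewrite -(braid_lconn br).
Qed.

Lemma setact_conj_class g t : g \in braid_group d s ->
  ('P^* (conj_class t) g)%act = conj_class (g t).
Proof.
move=> gB; apply/setP => u; apply/imsetP/imsetP.
  by move=> [_ /imsetP[h _ ->] ->]; exists h; rewrite //= /aperm braid_group_conj.
move=> [h _ ->]; exists (conj_tuple t h); first exact: imset_f.
by rewrite /= /aperm braid_group_conj.
Qed.

Lemma conj_tuple_class t h : conj_class (conj_tuple t h) = conj_class t.
Proof.
have tM g g' : conj_tuple (conj_tuple t g) g' = conj_tuple t (g * g').
  by apply/ffunP => i; rewrite !ffunE conjgM.
apply/setP => u; apply/imsetP/imsetP => -[g _ ->].
  by exists (h * g); rewrite ?inE // tM.
by exists (h^-1 * g); rewrite ?inE // tM mulKVg.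
Qed.

(** Braiding commutes with simultaneous conjugation, so orbits on conjugation classes correspond to
    lists up to braiding and conjugation. *)
Lemma irreducible_of_lists eta : 0 < d ->
  (exists t, hurwitz_tuple eta t) ->
  (forall t u, hurwitz_tuple eta t -> hurwitz_tuple eta u ->
     exists h, braid (tlist t) (conjl h (tlist u))) ->
  hurwitz_space_irreducible d eta.
Proof.
move=> d0 [t0 ht0] H; apply/imsetP; exists (conj_class t0).
  by apply/imsetP; exists t0; rewrite ?inE.
apply/setP => C; apply/imsetP/orbitP.
  move=> [u]; rewrite inE => hu ->.
  have [h br] := H _ _ ht0 hu; rewrite -tlist_conj in br.
  have [g gB /tlist_inj gE] := list_braid_group br erefl.
  by exists g; rewrite // setact_conj_class // gE conj_tuple_class.
move=> [g gB <-]; exists (g t0); last by rewrite setact_conj_class.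
by rewrite inE braid_group_hurwitz.
Qed.

End Bridge.

(** * The theorem *)

Section Partitions.
Variable d : nat.
Implicit Types (p : seq nat) (e : seq (seq nat)).

Lemma size_partition p : is_partition_of d p -> size p <= d.
Proof.
move=> /and3P[_ p0 /eqP <-]; elim: p p0 => //= n p IH.
by rewrite inE negb_or eq_sym -lt0n => /andP[n0 /IH]; lia.
Qed.

Lemma transposition_partition : is_partition_of d (transposition_type d) -> 1 < d.
Proof. by move=> /and3P[_ _ /eqP <-]. Qed.

Lemma rank_transposition_type (x : 'S_d) : 1 < d ->
  cycle_type x = transposition_type d -> rank x = 1.
Proof. by move=> d1; rewrite rank_cycle_type => ->; rewrite /= size_nseq; lia. Qed.

Lemma cycle_type_rank1 (x : 'S_d) : is_partition_of d (transposition_type d) ->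
  rank x = 1 -> cycle_type x = transposition_type d.
Proof.
move=> tp x1; have [y yt] := exists_cycle_type tp.
have y1 := rank_transposition_type (transposition_partition tp) yt.
by have [g <-] := rank1_conj y1 x1; rewrite cycle_typeJ.
Qed.

Lemma exists_cycle_types e : all (is_partition_of d) e ->
  exists X : seq 'S_d, map (@cycle_type d) X = e.
Proof.
elim: e => [|p e IH] /=; first by exists [::].
move=> /andP[/exists_cycle_type[x xp] /IH[X Xe]]; exists (x :: X).
by rewrite /= xp Xe.
Qed.

Lemma classes_of_cycle_types (X Y : seq 'S_d) :
  map (@cycle_type d) X = map (@cycle_type d) Y -> classes_of X = classes_of Y.
Proof.
elim: X Y => [|x X IH] [|y Y] //= [/cycle_type_conj[g ->] /IH XY].
by rewrite /classes_of /= classGidl ?inE // -!/(classes_of _) XY.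
Qed.

Lemma sumn_rank_types (X : seq 'S_d) : sumn (map (@rank _) X) =
  sumn (map (fun p => d - size p) (map (@cycle_type d) X)).
Proof. by rewrite -map_comp; congr sumn; apply: eq_map => x /=; rewrite rank_cycle_type. Qed.

Lemma is_cycle_types (X : seq 'S_d) : all pure (behead (map (@cycle_type d) X)) ->
  all (@is_cycle _) (behead X).
Proof.
by case: X => //= x X; rewrite all_map; apply: sub_all => y; exact: pure_is_cycle.
Qed.

Lemma behead_pure e1 e2 : size e1 <= 1 -> all pure e2 -> all pure (behead (e1 ++ e2)).
Proof. by case: e1 => [|p [|]] //= _ pe2; apply/allP => q /mem_behead; exact/allP. Qed.

End Partitions.

(** A partition of [d] has at most [d] parts, so truncated differences agree with the integral
    ones. *)
Lemma riemann_hurwitz_nat (d g s : nat) (eta : s.-tuple (seq nat)) :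
  all (is_partition_of d) eta ->
  (2 * g%:Z - 2 = - (2 * d%:Z)
         + \sum_(i < s) (d%:Z - (size (tnth eta i))%:Z))%R ->
  sumn (map (fun p => d - size p) eta) + 2 = d.*2 + g.*2.
Proof.
move=> /allP etap.
have -> : (\sum_(i < s) (d%:Z - (size (tnth eta i))%:Z) =
    (sumn (map (fun p => (d - size p)%N) eta))%:Z)%R.
  rewrite sumnE big_map (big_morph Posz PoszD (erefl _)) -(big_tuple _ _ eta predT (fun p => d%:Z - (size p)%:Z)%R).
  by apply: eq_big_seq => p /etap/size_partition; exact: subzn.
lia.
Qed.

Unset Implicit Arguments.

Theorem theorem1p6 (d g s : nat) (eta : s.-tuple (seq nat))
    (d_gt0 : 0 < d)
    (eta_part : forall p, p \in eta -> is_partition_of d p)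
    (eta_nontriv : forall p, p \in eta -> p <> nseq d 1)
    (riemann_hurwitz :
      (2 * g%:Z - 2 = - (2 * d%:Z)
         + \sum_(i < s) (d%:Z - (size (tnth eta i))%:Z))%R)
    (at_most_one_nonpure : count (fun p => ~~ pure p) eta <= 1)
    (many_transpositions :
      3 * g + (d - 1) <= count (fun p => p == transposition_type d) eta) :
  hurwitz_space_irreducible d eta.
Proof.
have /allP etap := eta_part.
have RH := riemann_hurwitz_nat etap riemann_hurwitz.
set tt := transposition_type d in many_transpositions.
(* A nonpure type, if present, comes first; [e1 ++ e2] will be the types of [X] and [e3] those of
   [Tr]. *)
pose e1 := [seq p <- [seq p <- eta | p != tt] | ~~ pure p].
pose e2 := [seq p <- [seq p <- eta | p != tt] | pure p].
pose e3 := [seq p <- eta | p == tt].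
have pe : perm_eq ((e1 ++ e2) ++ e3) eta.
  apply: perm_trans (permEl (perm_filterC (pred1 tt) eta)).
  rewrite perm_catC perm_cat2l perm_catC.
  exact: permEl (perm_filterC pure _).
have e3E : e3 = nseq (size e3) tt.
  by apply/all_pred1P/allP => p; rewrite mem_filter => /andP[].
have s1 : size e1 <= 1.
  apply: leq_trans at_most_one_nonpure; rewrite size_filter count_filter.
  by apply: sub_count => p /= /andP[].
have pure12 : all pure (behead (e1 ++ e2)) by apply: behead_pure => //; exact: filter_all.
have part12 : all (is_partition_of d) (e1 ++ e2).
  by apply/allP => p pin; apply: (allP etap); rewrite -(perm_mem pe) mem_cat pin.
(* For [d = 1] the list [[:: 2]] is no partition of [d]; only an occurrence in [eta] guarantees that
   [tt] is one. *)
have tt_part : 0 < size e3 -> is_partition_of d tt.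
  move=> e30; apply: (allP etap); rewrite -(perm_mem pe) mem_cat e3E.
  by rewrite mem_nseq e30 eqxx orbT.
pose w (p : seq nat) := d - size p.
have sum_e : sumn (map w (e1 ++ e2)) + size e3 = sumn (map w eta).
  rewrite -(perm_sumn (perm_map w pe)) [map w ((e1 ++ e2) ++ e3)]map_cat sumn_cat; congr (_ + _).
  rewrite [in RHS]e3E map_nseq sumn_nseq /w /= size_nseq.
  case: posnP tt_part => [->|_ /(_ isT)/transposition_partition d1]; first by rewrite muln0.
  by have -> : d - (d - 2).+1 = 1 by [lia]; rewrite mul1n.
have N3 : 3 * g + (d - 1) <= size e3 by rewrite size_filter.
have sum_lt : sumn (map w (e1 ++ e2)) < #|'I_d|.
  by rewrite card_ord; move: RH sum_e N3; rewrite -/w; lia.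
have split_types l : map (@cycle_type d) l = (e1 ++ e2) ++ e3 ->
    exists X Tr, [/\ l = X ++ Tr, map (@cycle_type d) X = e1 ++ e2, map (@cycle_type d) Tr = e3,
      transp Tr & size Tr = size e3].
  move=> le; exists (take (size (e1 ++ e2)) l), (drop (size (e1 ++ e2)) l).
  have E3 : map (@cycle_type d) (drop (size (e1 ++ e2)) l) = e3 by rewrite map_drop le drop_size_cat.
  split=> //; rewrite ?cat_take_drop // ?map_take ?le ?take_size_cat //; last by rewrite -E3 size_map.
  apply/allP => x /(map_f (@cycle_type d)); rewrite E3 => xe; apply/eqP.
  have e30 : 0 < size e3 by case: (e3) xe.
  apply: rank_transposition_type (transposition_partition (tt_part e30)) _.
  by move: xe; rewrite mem_filter => /andP[/eqP].
apply: (irreducible_of_lists d_gt0).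
  have [X0 X0e] := exists_cycle_types part12.
  have [||||X [Tr [XX0 tTr sTr p1 tr]]] := @braid_exists _ X0 (size e3) g.
  - by apply: is_cycle_types; rewrite X0e.
  - by rewrite sumn_rank_types X0e.
  (* For [d <= 1] no transposition occurs, so the bound on their number forces [g = 0]. *)
  - rewrite card_ord; case: (ltnP 1 d) => [|d1]; [by right|left].
    have : size e3 = 0.
      by apply/eqP; rewrite -leqn0 leqNgt; apply/negP => /tt_part/transposition_partition; lia.
    by lia.
  - by rewrite card_ord sumn_rank_types X0e -/w addnC -/w; move: RH sum_e; rewrite -/w; lia.
  have ctX : map (@cycle_type d) X = e1 ++ e2.
    by rewrite -X0e; apply: map_classes XX0 => x h; exact: cycle_typeJ.
  have ctT : map (@cycle_type d) Tr = e3.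
    rewrite e3E -sTr -(size_map (@cycle_type d)); apply/all_pred1P; rewrite all_map.
    apply/allP => x xT /=; apply/eqP/cycle_type_rank1; last by apply/eqP; exact: (allP tTr).
    by apply: tt_part; rewrite -sTr; case: (Tr) xT.
  have pX : perm_eq (map (@cycle_type d) (X ++ Tr)) eta by rewrite map_cat ctX ctT.
  have [|t tE] := @tlist_surj d s (X ++ Tr).
    by have := perm_size pX; rewrite size_map size_tuple.
  by exists t; apply/(hurwitz_tupleP _ _ d_gt0); rewrite tE.
move=> t u /(hurwitz_tupleP _ _ d_gt0)[pt p1t trt] /(hurwitz_tupleP _ _ d_gt0)[pu p1u tru].
have pe' : perm_eq eta ((e1 ++ e2) ++ e3) by rewrite perm_sym.
have [lt brt tE] := braid_sort (@cycle_typeJ d) (perm_trans pt pe').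
have [lu bru uE] := braid_sort (@cycle_typeJ d) (perm_trans pu pe').
have [X [Tr [ltE cX cT tT sT]]] := split_types _ tE.
have [X' [Tr' [luE cX' cT' tT' sT']]] := split_types _ uE.
subst lt lu.
have [||||||||h br] := @braid_unique _ X Tr X' Tr' tT tT'.
- by move=> a b; rewrite -(braid_lconn brt).
- by move=> a b; rewrite -(braid_lconn bru).
- by rewrite -(braid_prodl brt).
- by rewrite -(braid_prodl bru).
- by apply: is_cycle_types; rewrite cX.
- by apply: classes_of_cycle_types; rewrite cX cX'.
- by rewrite sT sT'.
- by rewrite sumn_rank_types cX.
exists h; apply: (braid_trans brt); apply: (braid_trans br).
exact/braid_conjl/braid_sym.
Qed.
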